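(* Let $E\subset\mathbb{H}^n$ be a closed subset with $C^1$ boundary $S=\partial E$. Let $N$ be the outer unit normal to $S$ and $\nu=N_h/|N_h|$ the corresponding horizontal unit normal (defined where $N_h\neq 0$). Take $p\notin E$ and $q\in S$ such that $\delta_E(p)=d(p,q)$, and consider a minimizing geodesic $\gamma:[0,\delta_E(p)]\to\mathbb{H}^n$, parameterized by arc-length and of curvature $\lambda$, with $\gamma(0)=q$ and $\gamma(\delta_E(p))=p$. Then: (i) $q$ is a regular point of $S$; (ii) $\dot\gamma(0)=\nu_q$; (iii) the curvature of $\gamma$ is given by $$\lambda=\frac{2\langle N,T\rangle}{|N_h|}(q).$$ Moreover, in case $N$ is a Euclidean Lipschitz vector field, the function $\lambda=2\langle N,T\rangle/|N_h|$ is locally Lipschitz in $S\setminus S_0$.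
   Context: $\mathbb{H}^n$ is $\mathbb{R}^{2n+1}$ with coordinates $(x_1,y_1,\ldots,x_n,y_n,t)$, with the left-invariant vector fields $X_i=\partial_{x_i}+y_i\partial_t$, $Y_i=\partial_{y_i}-x_i\partial_t$ ($1\le i\le n$), $T=\partial_t$, and $n\ge 1$. The horizontal distribution $\mathcal{H}$ is spanned by the $X_i,Y_i$; $\langle\cdot,\cdot\rangle$ is the Riemannian metric making $\{X_i,Y_i,T\}$ orthonormal; $J$ is given by $J(X_i)=Y_i$, $J(Y_i)=-X_i$, $J(T)=0$; for a vector $V$, $V_h=V-\langle V,T\rangle T$ is its horizontal projection. $\nabla$ is the pseudo-hermitian connection: the metric connection for which all $X_i,Y_i,T$ are parallel. A curve is horizontal if its velocity lies in $\mathcal{H}$; $d$ is the Carnot-Carathéodory distance (infimum of Riemannian lengths of piecewise smooth horizontal curves joining two points). A unit-speed geodesic of curvature $\lambda\in\mathbb{R}$ is a smooth horizontal unit-speed curve with $\nabla_{\dot\gamma}\dot\gamma+\lambda J(\dot\gamma)=0$; every minimizing geodesic (curve realizing the distance $d$, parameterized by arc-length) is such a curve for a unique $\lambda$. $\delta_E(p)=\inf\{d(p,q):q\in E\}$. For a set with $C^1$ boundary $S$, a point $q\in S$ is singular if $T_qS=\mathcal{H}_q$ and regular otherwise; $S_0\subset S$ is the set of singular points. *)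

(* Defs.v *)
From HB Require Import structures.
From mathcomp Require Import all_boot all_order all_algebra.
From mathcomp Require Import all_classical all_reals all_analysis.
From mathcomp Require Import ring.

Set Implicit Arguments.
Unset Strict Implicit.
Unset Printing Implicit Defensive.

Import Order.TTheory GRing.Theory Num.Theory.
Import numFieldNormedType.Exports.

Local Open Scope classical_set_scope.
Local Open Scope ring_scope.

(* A point of H^n is ((x, y), t), with x = (x_1, .., x_n), y = (y_1, .., y_n).
   A tangent vector at any point is given by its Euclidean components, in the
   same type. The library's norm on this type is the sup norm; it induces the
   Euclidean topology and the same Lipschitz maps as the Euclidean norm. *)
Notation heis R n := ('rV[R]_n * 'rV[R]_n * R)%type.

Section Heisenberg.
Context {R : realType} {n : nat}.
Implicit Types (p q v w : heis R n) (i : 'I_n).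

Definition Xfield i p : heis R n := ((delta_mx 0 i, 0), p.1.2 0 i).
Definition Yfield i p : heis R n := ((0, delta_mx 0 i), - p.1.1 0 i).
Definition Tfield : heis R n := ((0, 0), 1).

(* Coefficients of v in the basis X_i(p), Y_i(p), T; see frame_expansion. *)
Definition Xcoef v i : R := v.1.1 0 i.
Definition Ycoef v i : R := v.1.2 0 i.
Definition Tcoef p v : R :=
  v.2 - \sum_i (v.1.1 0 i * p.1.2 0 i - v.1.2 0 i * p.1.1 0 i).

Definition horizontal p : set (heis R n) :=
  [set v | exists a b : 'I_n -> R,
    v = \sum_i (a i *: Xfield i p + b i *: Yfield i p)].

(* The metric for which the frame is orthonormal; see metric_frame. *)
Definition metric p v w : R :=
  \sum_i (Xcoef v i * Xcoef w i + Ycoef v i * Ycoef w i)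
  + Tcoef p v * Tcoef p w.

Definition mnorm p v : R := Num.sqrt (metric p v v).

Definition Jmap p v : heis R n :=
  \sum_i (Xcoef v i *: Yfield i p - Ycoef v i *: Xfield i p).

Definition hproj p v : heis R n := v - metric p v Tfield *: Tfield.

Lemma frame_expansion p v :
  v = \sum_i (Xcoef v i *: Xfield i p + Ycoef v i *: Yfield i p)
      + Tcoef p v *: Tfield.
Proof.
have pair_sum (F : 'I_n -> heis R n) :
    \sum_i F i = ((\sum_i (F i).1.1, \sum_i (F i).1.2), \sum_i (F i).2).
  elim: (index_enum _) => [|i r IH]; first by rewrite !big_nil.
  by rewrite !big_cons IH.
rewrite pair_sum; case: v => -[a b] c; congr ((_, _), _) => /=.
- rewrite [X in _ + X]scaler0 addr0 [LHS]row_sum_delta.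
  by apply: eq_bigr => i _; rewrite scaler0 addr0.
- rewrite [X in _ + X]scaler0 addr0 [LHS]row_sum_delta.
  by apply: eq_bigr => i _; rewrite scaler0 add0r.
- rewrite [_ *: 1]mulr1 /Tcoef /= addrC -[LHS](subrK
    (\sum_i (a 0 i * p.1.2 0 i - b 0 i * p.1.1 0 i))).
  by congr (_ + _); apply: eq_bigr => i _; rewrite -mulrN.
Qed.

Lemma Tcoef_Xfield p i : Tcoef p (Xfield i p) = 0.
Proof.
rewrite /Tcoef /= (bigD1 i) //= big1 => [|j ji]; rewrite !mxE ?eqxx ?(negbTE ji);
  by rewrite ?andbF /= ?mulr1n ?mulr0n; ring.
Qed.

Lemma Tcoef_Yfield p i : Tcoef p (Yfield i p) = 0.
Proof.
rewrite /Tcoef /= (bigD1 i) //= big1 => [|j ji]; rewrite !mxE ?eqxx ?(negbTE ji);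
  by rewrite ?andbF /= ?mulr1n ?mulr0n; ring.
Qed.

Lemma Tcoef_Tfield p : Tcoef p Tfield = 1.
Proof. by rewrite /Tcoef /= big1 ?subr0// => i _; rewrite !mxE !mul0r subrr. Qed.

Lemma metric_frame p i j :
  [/\ metric p (Xfield i p) (Xfield j p) = (i == j)%:R,
      metric p (Yfield i p) (Yfield j p) = (i == j)%:R,
      metric p (Xfield i p) (Yfield j p) = 0,
      metric p (Xfield i p) Tfield = 0 /\ metric p (Yfield i p) Tfield = 0
    & metric p Tfield Tfield = 1].
Proof.
have delta_sum : \sum_k ((k == i)%:R * (k == j)%:R) = (i == j)%:R :> R.
  rewrite (bigD1 i) //= eqxx mul1r big1 ?addr0 // => k /negbTE ->.
  by rewrite mul0r.
split; rewrite /metric ?Tcoef_Xfield ?Tcoef_Yfield ?Tcoef_Tfield /Xcoef /Ycoef /=.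
- rewrite mulr0 addr0 -delta_sum; apply: eq_bigr => k _.
  by rewrite !mxE !eqxx /= mul0r addr0.
- rewrite mulr0 addr0 -delta_sum; apply: eq_bigr => k _.
  by rewrite !mxE !eqxx /= mul0r add0r.
- by rewrite mulr0 addr0 big1 // => k _; rewrite !mxE mulr0 mul0r addr0.
- by split; rewrite mul0r addr0 big1 // => k _; rewrite !mxE !(mulr0, mul0r) addr0.
- by rewrite mul1r big1 ?add0r // => k _; rewrite !mxE mul0r addr0.
Qed.

End Heisenberg.

Section Curves.
Context {R : realType}.

(* Derivative at t of the restriction of f to [a, b] (one-sided at a and b). *)
Definition itv_derive (V : normedModType R) (a b : R) (f : R -> V) (t : R) : V :=
  lim ((fun s => (s - t)^-1 *: (f s - f t)) @ within `[a, b] t^').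

(* C^infinity on [a, b], up to the endpoints. *)
Definition smooth_on (V : normedModType R) (a b : R) (c : R -> V) : Prop :=
  exists2 g : R -> V, (forall k t, derivable (derive1n k g) t 1)
    & {in `[a, b], g =1 c}.

Context {n : nat}.
Implicit Types (c : R -> heis R n) (a b lambda : R).

Definition horizontal_on a b c : Prop :=
  {in `[a, b], forall t, horizontal (c t) (itv_derive a b c t)}.

(* On each closed piece of the subdivision, c is smooth up to the endpoints;
   in particular c is continuous on [a, b]. *)
Definition pw_smooth_horizontal a b c : Prop :=
  exists2 s : seq R, itv_partition a b s &
    forall k, (k < size s)%N ->
      smooth_on (nth b (a :: s) k) (nth b s k) c /\
      horizontal_on (nth b (a :: s) k) (nth b s k) c.

(* The speed is junk at the finitely many break points of c, a null set. *)
Definition curve_length a b c : R :=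
  \int[lebesgue_measure]_(t in `[a, b]) mnorm (c t) (itv_derive a b c t).

Definition cc_dist (p q : heis R n) : R :=
  inf [set l | exists a b c,
    [/\ pw_smooth_horizontal a b c, c a = p, c b = q & l = curve_length a b c]].

Definition dist_to (E : set (heis R n)) (p : heis R n) : R :=
  inf [set cc_dist p q | q in E].

(* Since the frame is parallel, the covariant derivative along c of a vector
   field V (a function of the parameter) differentiates its coefficients. *)
Definition cov_derive a b c (V : R -> heis R n) (t : R) : heis R n :=
  \sum_i (itv_derive a b (fun s => Xcoef (V s) i) t *: Xfield i (c t)
          + itv_derive a b (fun s => Ycoef (V s) i) t *: Yfield i (c t))
  + itv_derive a b (fun s => Tcoef (c s) (V s)) t *: Tfield.

(* Unit-speed geodesic of curvature lambda. *)
Definition geodesic a b lambda c : Prop :=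
  [/\ smooth_on a b c,
      horizontal_on a b c,
      {in `[a, b], forall t, mnorm (c t) (itv_derive a b c t) = 1}
    & {in `[a, b], forall t,
        cov_derive a b c (itv_derive a b c) t
        + lambda *: Jmap (c t) (itv_derive a b c t) = 0}].

Definition minimizing_geodesic a b lambda c : Prop :=
  geodesic a b lambda c /\ curve_length a b c = cc_dist (c a) (c b).

End Curves.

Section Hypersurfaces.
Context {R : realType} {n : nat}.
Implicit Types (E S U : set (heis R n)) (N : heis R n -> heis R n).

Definition boundary E : set (heis R n) := closure E `\` E°.

Definition C1_on U (f : heis R n -> R) : Prop :=
  forall z, U z -> differentiable f z /\
    forall v, {for z, continuous (fun z' => 'D_v f z')}.

(* Near each boundary point, E is the sublevel set {f <= 0} of a C^1 function
   f without critical points: E lies on one side of its boundary, so that an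
   outer normal makes sense. *)
Definition has_C1_boundary E : Prop :=
  forall q, boundary E q -> exists U f,
    [/\ open U, U q, C1_on U f,
        forall z, U z -> exists v, 'D_v f z != 0
      & E `&` U = [set z | U z /\ f z <= 0]].

(* T_q S: velocities at q of C^1 curves contained in S. *)
Definition tangent_space S (q : heis R n) : set (heis R n) :=
  [set v | exists (c : R -> heis R n) (e : R),
    [/\ 0 < e, c 0 = q, derive1 c 0 = v
      & forall s, `|s| < e ->
          [/\ S (c s), derivable c s 1 & {for s, continuous (derive1 c)}]]].

Definition singular_set S : set (heis R n) :=
  [set q | S q /\ tangent_space S q = horizontal q].

Definition regular_set S : set (heis R n) := S `\` singular_set S.

Definition outer_unit_normal E N : Prop :=
  forall q, boundary E q ->
    [/\ mnorm q (N q) = 1,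
        forall v, tangent_space (boundary E) q v -> metric q (N q) v = 0
      & \forall s \near 0^'+, ~ E (q + s *: N q)].

Definition horizontal_normal N (q : heis R n) : heis R n :=
  (mnorm q (hproj q (N q)))^-1 *: hproj q (N q).

Definition normal_curvature N (q : heis R n) : R :=
  2 * metric q (N q) Tfield / mnorm q (hproj q (N q)).

Definition locally_lipschitz_on (A : set (heis R n)) (f : heis R n -> R) : Prop :=
  forall q, A q -> exists2 U, nbhs q U & [lipschitz f z | z in A `&` U].

End Hypersurfaces.

(* Main.v *)
Require Import Defs.
From mathcomp Require Import all_boot all_order all_algebra.
From mathcomp Require Import all_classical all_reals all_analysis.
From mathcomp Require Import ring lra.
Import Order.TTheory GRing.Theory Num.Theory.
Import numFieldNormedType.Exports.
Set Implicit Arguments.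
Unset Strict Implicit.
Unset Printing Implicit Defensive.
Local Open Scope classical_set_scope.
Local Open Scope ring_scope.

(** The closed set [E] misses the open Carnot-Caratheodory ball of radius
[d = dist_to E p] around [p], and [q] lies on the boundary of both. A horizontal
curve that starts at [p] and is shorter than [d] therefore cannot end in [E]. The
minimizing geodesic, run backwards from [p] to [q], is tested against variations
that keep the end [p] and move the end [q].

If the end at [q] moves with velocity [D], the length changes at the rate
[- metric q Z D], where [Z = v + (lambda / 2) *: Tfield] and [v] is the velocity of
the geodesic at [q]. Indeed the derivative of the length is the integral of
x'.a' + y'.b' for a variation with horizontal coefficients (a, b). Integration by
parts gives the boundary term - <v, D_h> and, by the geodesic equation, lambda times
the integral of x'.b - y'.a, which is minus one half of the T-component that
horizontality forces on [D]. Every [D] occurs: a linear ramp produces the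
horizontal part, and a multiple of the rotated velocity (-y', x'), cut off at both
ends, adjusts the T-part freely because the speed is 1 (lemma
[variation_in_direction]). This surjectivity is what makes the statement true at
conjugate points as well, where the metric ball need not be smooth.

Let [f] be a local defining function of [E] near [q]. If 'D_D f q < 0, the moved
end enters [E], so the length cannot decrease, and [metric q Z D <= 0]. A linear form
which is nonpositive on an open half-space is a multiple of the form defining it
([proportional_of_sign]), so [metric q Z] is a positive multiple of the differential
of [f]. The normal [N q] is dual to another positive multiple of it
([normal_conormal]). This uses that every vector of the kernel of the differential
is the velocity of a C^1 curve in the boundary, which is the implicit function
theorem for curves ([implicit_curve]). Hence [N q] is a positive multiple of [Z],
which gives the direction of the geodesic and its curvature. If [q] were singular,
the differential would vanish on all horizontal vectors, in particular on [v],
whereas [metric q Z v = 1].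

For the last assertion, the same description of the tangent space shows that the
horizontal part of [N] does not vanish at a regular point. Near such a point
the curvature is a quotient of bounded Lipschitz functions whose denominator is
bounded away from 0 ([normal_curvature_lipschitz]). *)

(** * Smooth functions on the line *)

Section Smooth.
Context {R : realType}.

(** The requirement of [smooth_on] on the extension, sealed in a record so that
automation does not unfold it into derivability goals. *)
Record smooth (V : normedModType R) (g : R -> V) : Prop := Smooth {
  derivable_derive1n : forall k t, derivable (derive1n k g) t 1 }.

(** Coinduction: a class of differentiable functions that is stable under derivation
consists of smooth functions. *)
Lemma smooth_coind (V : normedModType R) (P : (R -> V) -> Prop) :
  (forall f, P f -> (forall t, derivable f t 1) /\ P (derive1 f)) ->
  forall f, P f -> smooth f.
Proof.
move=> PP f Pf; split=> k; elim: k f Pf => [|k IH] f /PP[df Pf'] t; first exact: df.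
by rewrite derive1Sn; exact: IH.
Qed.

Lemma smooth_derivable (V : normedModType R) (g : R -> V) (t : R) :
  smooth g -> derivable g t 1.
Proof. by case=> /(_ 0). Qed.

Lemma smooth_derive1 (V : normedModType R) (g : R -> V) :
  smooth g -> smooth (derive1 g).
Proof. by case=> sg; split=> k t; rewrite -derive1Sn; exact: sg. Qed.

Lemma smooth_continuous (V : normedModType R) (g : R -> V) :
  smooth g -> continuous g.
Proof.
by move=> sg t; apply/differentiable_continuous/derivable1_diffP/smooth_derivable.
Qed.

Lemma smooth_is_derive (V : normedModType R) (g : R -> V) (t : R) :
  smooth g -> is_derive t 1 g (derive1 g t).
Proof. by move=> sg; apply: DeriveDef; [exact: smooth_derivable|rewrite derive1E]. Qed.

Lemma is_derive_derive1 (V : normedModType R) (g g' : R -> V) :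
  (forall t : R, is_derive t 1 g (g' t)) ->
  (forall t, derivable g t 1) /\ derive1 g = g'.
Proof. by move=> dg; split=> [t|]; [|apply/funext => t; rewrite derive1E derive_val]. Qed.

Lemma smooth_primitive (V : normedModType R) (F f : R -> V) :
  smooth f -> (forall t : R, is_derive t 1 F (f t)) -> smooth F.
Proof.
case=> sf /is_derive_derive1[dF F']; split=> -[|k] t; first exact: dF.
by rewrite derive1Sn F'; exact: sf.
Qed.

(** The derivative of a product is a sum of two products; closing the class under
both operations makes it stable under derivation, so that [smooth_coind] applies. *)
Inductive poly_in_smooth : (R -> R) -> Prop :=
| poly_smooth f of smooth f : poly_in_smooth f
| poly_add f g of poly_in_smooth f & poly_in_smooth g :
    poly_in_smooth (fun t => f t + g t)
| poly_mul f g of poly_in_smooth f & poly_in_smooth g :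
    poly_in_smooth (fun t => f t * g t).

Lemma poly_in_smooth_smooth f : poly_in_smooth f -> smooth f.
Proof.
apply: smooth_coind => {}f; elim=> {f} [f sf|f g _ [df pf] _ [dg pg]|f g pf0 [df pf] pg0 [dg pg]].
- by split=> [t|]; [exact: smooth_derivable|exact/poly_smooth/smooth_derive1].
- split=> [t|]; first exact: derivableD.
  rewrite (_ : derive1 _ = fun t => derive1 f t + derive1 g t); first exact: poly_add.
  by apply/funext => t; rewrite !derive1E deriveD.
- split=> [t|]; first exact: derivableM.
  rewrite (_ : derive1 _ = fun t => f t * derive1 g t + g t * derive1 f t).
    by apply: poly_add; exact: poly_mul.
  by apply/funext => t; rewrite !derive1E deriveM.
Qed.

Lemma smoothD (f g : R -> R) : smooth f -> smooth g -> smooth (fun t => f t + g t).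
Proof. by move=> *; apply/poly_in_smooth_smooth/poly_add; exact: poly_smooth. Qed.

Lemma smoothM (f g : R -> R) : smooth f -> smooth g -> smooth (fun t => f t * g t).
Proof. by move=> *; apply/poly_in_smooth_smooth/poly_mul; exact: poly_smooth. Qed.

Lemma smooth_cst (V : normedModType R) (a : V) : smooth (fun _ : R => a).
Proof.
apply: (@smooth_coind _ (fun f => exists a, f = cst a)) => [f [{}a ->]|]; last by exists a.
split=> [t|]; first exact: derivable_cst.
by exists 0; apply/funext => t; rewrite derive1_cst.
Qed.

Lemma smooth_id : smooth (fun t : R => t).
Proof.
apply: (@smooth_primitive _ _ (fun=> (1 : R))); exact: smooth_cst.
Qed.

Lemma smoothN (f : R -> R) : smooth f -> smooth (fun t => - f t).
Proof.
move=> sf; rewrite (_ : (fun _ => _) = fun t => (-1) * f t); last first.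
  by apply/funext => t; rewrite mulN1r.
by apply: smoothM => //; exact: smooth_cst.
Qed.

Lemma smooth_sum (I : Type) (r : seq I) (F : I -> R -> R) :
  (forall i, smooth (F i)) -> smooth (fun t => \sum_(i <- r) F i t).
Proof.
move=> sF; elim: r => [|i r IH].
  rewrite (_ : (fun _ => _) = fun=> 0); first exact: smooth_cst.
  by apply/funext => t; rewrite big_nil.
rewrite (_ : (fun _ => _) = fun t => F i t + \sum_(i <- r) F i t).
  exact: smoothD.
by apply/funext => t; rewrite big_cons.
Qed.

Lemma is_derive_reverse (f : R -> R) (d t : R) : derivable f (d - t) 1 ->
  is_derive t 1 (fun s => f (d - s)) (- derive1 f (d - t)).
Proof.
move=> df.
have dr : is_derive t 1 (fun s : R => d - s) (-1).
  by rewrite -[X in is_derive _ _ _ X]sub0r; exact: is_deriveB.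
apply: DeriveDef.
  apply/derivable1_diffP; apply: (@differentiable_comp _ _ _ _ (fun s : R => d - s) f).
    exact/derivable1_diffP.
  exact/derivable1_diffP.
rewrite -derive1E (@derive1_comp _ (fun s : R => d - s) f) //.
by rewrite [X in _ * X]derive1E [X in _ * X]derive_val mulrN1.
Qed.

Lemma smooth_reverse (f : R -> R) (d : R) : smooth f -> smooth (fun t => f (d - t)).
Proof.
move=> sf; apply: (@smooth_coind _ (fun h : R -> R => exists (k : R) (f : R -> R), smooth f /\
    h = fun t => k * f (d - t))); last first.
  by exists 1, f; split => //; apply/funext => t; rewrite mul1r.
move=> _ [k [{}f [{}sf ->]]].
have dk (t : R) : is_derive t 1 (fun s => k * f (d - s)) (- k * derive1 f (d - t)).
  have h : is_derive t 1 _ _ := is_derive_reverse (smooth_derivable (t := d - t) sf).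
  by rewrite mulNr -mulrN; exact: is_deriveZ.
split=> [t|]; first by case: (dk t).
exists (- k), (derive1 f); split; first exact: smooth_derive1.
by apply/funext => t; rewrite derive1E; case: (dk t).
Qed.

(** The primitive has to live on the whole line, since smoothness on a segment asks
for a smooth extension; hence the oriented integral. On each half-line bounded below
by some [a <= 0] it differs by a constant from the integral from [a] to [x], to which
the fundamental theorem applies. *)
Lemma exists_primitive (f : R -> R) : continuous f ->
  exists F : R -> R, F 0 = 0 /\ forall t : R, is_derive t 1 F (f t).
Proof.
move=> cf.
pose mu := @lebesgue_measure R.
pose I a b := \int[mu]_(t in `[a, b]) f t.
have intf a b : mu.-integrable `[a, b] (EFin \o f).
  apply: continuous_compact_integrable; first exact: segment_compact.
  exact: continuous_subspaceT.
have chasles a b c : a <= b -> b <= c -> I a c = I a b + I b c.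
  move=> ab bc; rewrite /I -(@Rintegral_itv_obnd_cbnd _ b (BRight c)); last first.
    apply: integrableS (intf b c) => // x /=.
    by rewrite !in_itv/= => /andP[/ltW-> ->].
  rewrite -(@Rintegral_itvB _ f (BLeft a) (BRight c) b) //.
  by rewrite addrC subrK.
have Iaa a : I a a = 0 by rewrite /I set_itv1 Rintegral_set1.
pose F x := I 0 x - I x 0.
have I0 a b : b < a -> I a b = 0.
  by move=> ba; rewrite /I set_itv_ge ?Rintegral_set0// bnd_simp -ltNge.
have FE a x : a <= x -> a <= 0 -> F x = I a x - I a 0.
  move=> ax a0; rewrite /F; have [x0|x0] := ltP x 0.
    by rewrite I0 // (chasles a x 0 ax (ltW x0)); ring.
  rewrite (chasles a 0 x a0 x0) ; move: x0; rewrite le_eqVlt => /predU1P[<-|x0].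
    by rewrite Iaa; ring.
  by rewrite (I0 x)//; ring.
exists F; split; first by rewrite /F subrr.
move=> t; pose a := Num.min t 0 - 1.
have at_ : a < t by rewrite /a ltrBlDr (@le_lt_trans _ _ t) ?ge_min ?lexx ?ltrDl.
have a0 : a <= 0 by rewrite /a lerBlDr add0r (@le_trans _ _ 0) ?ge_min ?lexx ?orbT.
have tu : t < t + 1 by rewrite ltrDl.
have [dI I'] := continuous_FTC1_closed tu (intf a (t + 1)) at_ (cf t).
apply: (@near_eq_is_derive _ _ _ (fun x => I a x - I a 0)).
  near=> x; rewrite (FE a) //.
  by near: x; apply: (@cvgr_ge _ _ _ _ id t) => //; exact: cvg_id.
rewrite -[f t]subr0; apply: is_deriveB.
by apply: DeriveDef => //; rewrite -derive1E.
Unshelve. all: by end_near. Qed.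

End Smooth.

(** * One-sided derivatives and coordinates of curves *)

Section ItvDerive.
Context {R : realType}.

(** Uniqueness of the limit that defines [itv_derive], including at the two ends of
the segment. *)
Lemma itv_dnbhs_proper (a b t : R) : a < b -> t \in `[a, b] ->
  ProperFilter (within `[a, b] t^').
Proof.
move=> ab tab; apply: Build_ProperFilter_ex => P [d d0 dP].
have : exists s, [/\ s \in `[a, b], s != t & `|t - s| < d].
  move: tab; rewrite in_itv/= => /andP[at_ tb].
  have [tb'|bt] := ltP t b.
    exists (t + Num.min (d / 2) (b - t)); set m := Num.min _ _.
    have m0 : 0 < m by rewrite lt_min divr_gt0//= subr_gt0.
    have md : m <= d / 2 by rewrite ge_min lexx.
    have mb : m <= b - t by rewrite ge_min lexx orbT.
    have d2 : d / 2 < d by move: d0 => /= d0; lra.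
    split; first by rewrite in_itv/=; apply/andP; split; lra.
      by rewrite gt_eqF // ltrDl.
    by rewrite opprD addNKr normrN gtr0_norm //; lra.
  have tb' : t = b by apply/eqP; rewrite eq_le tb bt.
  exists (t - Num.min (d / 2) (b - a)); set m := Num.min _ _.
  have m0 : 0 < m by rewrite lt_min divr_gt0//= subr_gt0.
  have md : m <= d / 2 by rewrite ge_min lexx.
  have mb : m <= b - a by rewrite ge_min lexx orbT.
  have d2 : d / 2 < d by move: d0 => /= d0; lra.
  split; first by rewrite in_itv/=; apply/andP; split; lra.
    by rewrite lt_eqF // ltrBlDr ltrDl.
  by rewrite opprB addrC subrK gtr0_norm //; lra.
by move=> [s [sab st sd]]; exists s; exact: dP.
Qed.

Lemma is_derive_cvg (V : normedModType R) (g : R -> V) (t : R) (v : V) :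
  is_derive t 1 g v -> (fun s => (s - t)^-1 *: (g s - g t)) @ t^' --> v.
Proof.
case=> dg <-; rewrite -derive1E; apply/cvgrPdist_lt => e e0.
have : (fun h => h^-1 *: (g (h + t) - g t)) @ 0^' --> derive1 g t.
  have -> : (fun h => h^-1 *: (g (h + t) - g t))
      = (fun h => h^-1 *: ((g \o shift t) (h *: (1 : R)) - g t)).
    by apply/funext => h /=; rewrite [h *: _]mulr1.
  by rewrite derive1E; exact: dg.
move=> /cvgrPdist_lt /(_ _ e0)[d /= d0 dP].
exists d => //= s ts st.
have := dP (s - t); rewrite subrK; apply; last by rewrite subr_eq0.
by rewrite /= sub0r opprB.
Qed.

Lemma itv_deriveE (V : normedModType R) (a b t : R) (f g : R -> V) (v : V) :
  a < b -> t \in `[a, b] -> {in `[a, b], g =1 f} -> is_derive t 1 g v ->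
  itv_derive a b f t = v.
Proof.
move=> ab tab gf /is_derive_cvg dg.
have pF := itv_dnbhs_proper ab tab.
apply: cvg_lim; first exact: norm_hausdorff.
have {}dg : (fun s => (s - t)^-1 *: (g s - g t)) @ within `[a, b] t^' --> v.
  exact: cvg_trans (cvg_app _ (cvg_within _)) dg.
apply: cvg_trans dg.
apply: near_eq_cvg; rewrite near_withinE; near=> s => sab.
by rewrite !gf.
Unshelve. all: by end_near. Qed.

End ItvDerive.

Section Coordinates.
Context {R : realType}.

Lemma is_derive_pair (V W : normedModType R) (f : R -> V) (g : R -> W) (t : R)
  (v : V) (w : W) :
  is_derive t 1 f v -> is_derive t 1 g w -> is_derive t 1 (fun s => (f s, g s)) (v, w).
Proof.
case=> /derivable1_diffP df <- [/derivable1_diffP dg <-].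
have dfg := differentiable_pair df dg.
apply: DeriveDef; first exact/derivable1_diffP.
by rewrite deriveE // diff_pair //= !deriveE.
Qed.

Lemma is_derive_fst (V W : normedModType R) (c : R -> V * W) (t : R) v :
  is_derive t 1 c v -> is_derive t 1 (fun s => (c s).1) v.1.
Proof.
move=> [dc <-].
have h : (fun h => h^-1 *: (((fun s => (c s).1) \o shift t) (h *: 1) - (c t).1)) @ 0^'
   --> ('D_1 c t).1.
  by apply: (cvg_comp _ fst dc); exact: cvg_fst.
by apply: DeriveDef; [apply/cvg_ex; eexists; exact: h|exact: cvg_lim h].
Qed.

Lemma is_derive_snd (V W : normedModType R) (c : R -> V * W) (t : R) v :
  is_derive t 1 c v -> is_derive t 1 (fun s => (c s).2) v.2.
Proof.
move=> [dc <-].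
have h : (fun h => h^-1 *: (((fun s => (c s).2) \o shift t) (h *: 1) - (c t).2)) @ 0^'
   --> ('D_1 c t).2.
  by apply: (cvg_comp _ snd dc); exact: cvg_snd.
by apply: DeriveDef; [apply/cvg_ex; eexists; exact: h|exact: cvg_lim h].
Qed.

Lemma is_derive_row n (X : 'I_n -> R -> R) (X' : 'I_n -> R) (t : R) :
  (forall i, is_derive t 1 (X i) (X' i)) ->
  is_derive t 1 (fun s => \row_i X i s : 'rV[R]_n) (\row_i X' i).
Proof.
move=> dX.
have dr : derivable (fun s => \row_i X i s : 'rV[R]_n) t 1.
  apply/derivable_mxP => i j.
  rewrite (_ : (fun _ => _) = X j); first by case: (dX j).
  by apply/funext => s; rewrite mxE.
apply: DeriveDef => //; rewrite derive_mx //.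
apply/rowP => j; rewrite !mxE.
rewrite (_ : (fun _ => _) = X j); first by case: (dX j).
by apply/funext => s; rewrite mxE.
Qed.

Lemma is_derive_entry n (c : R -> 'rV[R]_n) (t : R) v j :
  is_derive t 1 c v -> is_derive t 1 (fun s => c s 0 j) (v 0 j).
Proof.
move=> [dc <-]; rewrite derive_mx // mxE.
by apply: DeriveDef => //; apply: (derivable_mxP _ _ _).1.
Qed.

Context {n : nat}.

Definition curve (X Y : 'I_n -> R -> R) (Z : R -> R) (s : R) : heis R n :=
  ((\row_i X i s, \row_i Y i s), Z s).

Lemma is_derive_curve X Y Z (X' Y' : 'I_n -> R) (Z' : R) (t : R) :
  (forall i, is_derive t 1 (X i) (X' i)) -> (forall i, is_derive t 1 (Y i) (Y' i)) ->
  is_derive t 1 Z Z' ->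
  is_derive t 1 (curve X Y Z) ((\row_i X' i, \row_i Y' i), Z').
Proof.
by move=> dX dY dZ; do 2?[apply: is_derive_pair => //]; exact: is_derive_row.
Qed.

Lemma smooth_curve X Y Z : (forall i, smooth (X i)) -> (forall i, smooth (Y i)) ->
  smooth Z -> smooth (curve X Y Z).
Proof.
move=> sX sY sZ; apply: (@smooth_coind _ _ (fun c => exists X Y Z,
   [/\ forall i, smooth (X i), forall i, smooth (Y i), smooth Z & c = curve X Y Z]));
  last by exists X, Y, Z.
move=> _ {X Y Z sX sY sZ} [X [Y [Z [sX sY sZ ->]]]].
have [] := @is_derive_derive1 _ _ (curve X Y Z)
  (curve (fun i => derive1 (X i)) (fun i => derive1 (Y i)) (derive1 Z)).
  by move=> t; apply: is_derive_curve => *; exact: smooth_is_derive.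
move=> dc ->; split=> //.
exists (fun i => derive1 (X i)), (fun i => derive1 (Y i)), (derive1 Z).
by split=> // *; exact: smooth_derive1.
Qed.

Lemma smooth_coordinates (c : R -> heis R n) : smooth c ->
  [/\ forall i, smooth (fun t => (c t).1.1 0 i),
      forall i, smooth (fun t => (c t).1.2 0 i) & smooth (fun t => (c t).2)].
Proof.
move=> sc; split=> [i|i|].
- apply: (@smooth_coind _ _ (fun h : R -> R => exists2 c : R -> heis R n, smooth c &
    h = fun t => (c t).1.1 0 i)); last by exists c.
  move=> _ {c sc} [c sc ->].
  have [] := @is_derive_derive1 _ _ (fun t => (c t).1.1 0 i) (fun t => (derive1 c t).1.1 0 i).
    by move=> t; apply/is_derive_entry/is_derive_fst/is_derive_fst/smooth_is_derive.
  by move=> dc ->; split => //; exists (derive1 c) => //; exact: smooth_derive1.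
- apply: (@smooth_coind _ _ (fun h : R -> R => exists2 c : R -> heis R n, smooth c &
    h = fun t => (c t).1.2 0 i)); last by exists c.
  move=> _ {c sc} [c sc ->].
  have [] := @is_derive_derive1 _ _ (fun t => (c t).1.2 0 i) (fun t => (derive1 c t).1.2 0 i).
    by move=> t; apply/is_derive_entry/is_derive_snd/is_derive_fst/smooth_is_derive.
  by move=> dc ->; split => //; exists (derive1 c) => //; exact: smooth_derive1.
- apply: (@smooth_coind _ _ (fun h : R -> R => exists2 c : R -> heis R n, smooth c &
    h = fun t => (c t).2)); last by exists c.
  move=> _ {c sc} [c sc ->].
  have [] := @is_derive_derive1 _ _ (fun t => (c t).2) (fun t => (derive1 c t).2).
    by move=> t; apply/is_derive_snd/smooth_is_derive.
  by move=> dc ->; split => //; exists (derive1 c) => //; exact: smooth_derive1.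
Qed.

End Coordinates.

(** * Curves in the zero set of a C^1 function *)

Section Implicit.
Context {R : realType} {V : normedModType R}.
Implicit Types (f : V -> R) (q v w e z : V).

Lemma is_derive_along f (c : R -> V) (t : R) v :
  differentiable f (c t) -> is_derive t 1 c v ->
  is_derive t 1 (f \o c) ('D_v f (c t)).
Proof.
move=> df [/derivable1_diffP dc <-].
apply: DeriveDef; first exact/derivable1_diffP/differentiable_comp.
by rewrite !deriveE //; [rewrite diff_comp|exact: differentiable_comp].
Qed.

Lemma derive_lin f z (a b : R) v w : differentiable f z ->
  'D_(a *: v + b *: w) f z = a * 'D_v f z + b * 'D_w f z.
Proof. by move=> df; rewrite !deriveE // linearD !linearZ. Qed.

Lemma is_derive_scalel (h : R -> R) (t dh : R) w : is_derive t 1 h dh ->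
  is_derive t 1 (fun s => h s *: w) (dh *: w).
Proof.
move=> [hd <-]; have /derivable1_diffP hdiff := hd.
apply: DeriveDef; first exact/derivable1_diffP/differentiableZl.
rewrite deriveE; last exact: differentiableZl.
by rewrite diffZl //= deriveE.
Qed.

Lemma is_derive_line z w (t : R) : is_derive t 1 (fun s => z + s *: w) w.
Proof.
have -> : (fun s => z + s *: w) = cst z + (fun s : R => s *: w) by [].
have h : is_derive t 1 (fun s : R => s *: w) (1 *: w) by apply: is_derive_scalel.
by rewrite -[X in is_derive _ _ _ X]add0r -[w in X in is_derive _ _ _ X]scale1r; exact: is_deriveD.
Qed.

Lemma segment_mean_value f z w :
  (forall t : R, 0 <= t <= 1 -> differentiable f (z + t *: w)) ->
  exists2 t, 0 <= t <= 1 & f (z + w) - f z = 'D_w f (z + t *: w).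
Proof.
move=> df; pose h := f \o (fun s : R => z + s *: w).
have dh (t : R) : 0 <= t <= 1 -> is_derive t 1 h ('D_w f (z + t *: w)).
  by move=> /df dft; apply: is_derive_along => //; exact: is_derive_line.
have [t||t t01] := @MVT R h (fun t => 'D_w f (z + t *: w)) 0 1 ltr01.
- by rewrite in_itv/= => /andP[t0 t1]; apply: dh; rewrite !ltW.
- apply: derivable_within_continuous => t; rewrite in_itv/= => t01.
  by have [] := dh _ t01.
- rewrite /h/= scale1r scale0r addr0 subr0 mulr1 => ->; exists t => //.
  by move: t01; rewrite in_itv/= => /andP[t0 t1]; rewrite !ltW.
Qed.

(** The implicit function theorem for curves: solve f (q + s v + g(s) e) = 0 for
[g], where [e] is transverse to the level set. A single mean value argument on
segments does everything. It shows that [f] has opposite signs at u = |s| and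
u = - |s|, so that a solution exists by the intermediate value theorem. Applied to
two solutions, it expresses the difference quotient of [g] as the value of
[- 'D_v f / 'D_e f] at a point of the segment between them, so that [g] is first
Lipschitz and then C^1 by continuity of that ratio. *)
Lemma implicit_curve f (U : set V) q v e :
  open U -> U q -> (forall z, U z -> differentiable f z) ->
  (forall z w, U z -> {for z, continuous (fun z' => 'D_w f z')}) ->
  f q = 0 -> 'D_v f q = 0 -> 'D_e f q != 0 ->
  exists (c : R -> V) (r : R), [/\ 0 < r, c 0 = q, derive1 c 0 = v &
    forall s : R, `|s| < r -> [/\ U (c s), f (c s) = 0, derivable c s 1 &
      {for s, continuous (derive1 c)}]].
Proof.
move=> oU Uq df cf fq Dv; wlog De : e / 'D_e f q = 1.
  move=> wl De0; have De1 : 'D_(('D_e f q)^-1 *: e) f q = 1.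
    rewrite -[X in 'D_X _ _]addr0 -[0](scale0r e) derive_lin; last exact: df _ Uq.
    by rewrite mul0r addr0 mulVf.
  by apply: (wl _ De1); rewrite De1 oner_eq0.
move=> _.
have [r r0 rP] : exists2 r, 0 < r & forall z, `|z - q| < r ->
    [/\ U z, 1 / 2 < 'D_e f z & `|'D_v f z| < 1 / 4].
  have : \forall z \near q, [/\ U z, 1 / 2 < 'D_e f z & `|'D_v f z| < 1 / 4].
    near=> z; split; near: z.
    - exact: open_nbhs_nbhs.
    - by apply: (cvgr_gt ('D_e f q)); [exact: cf|rewrite De; lra].
    - have /cvgr_dist_lt /(_ (1/4)) := cf q v Uq.
      rewrite Dv; have d4 : 0 < 1 / 4 :> R by lra.
      by move=> /(_ d4); apply: filterS => z; rewrite sub0r normrN.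
  move=> /nbhs_normP[r /= r0 rP]; exists r => // z zq; apply: rP.
  by rewrite /ball_/= distrC.
(* [eps] keeps q + s v + u e in the ball of radius r when |u| <= |s| < eps. *)
pose N := `|v| + `|e| + 1; have N0 : 0 < N by rewrite ltr_wpDl // addr_ge0.
pose eps := r / N; have eps0 : 0 < eps by rewrite divr_gt0.
pose pt (s u : R) := q + (s *: v + u *: e).
have pt_in s u t : `|s| < eps -> `|u| <= `|s| -> `|t| <= 1 ->
    `|t *: (s *: v + u *: e)| < r.
  move=> se us t1; rewrite normrZ.
  apply: (@le_lt_trans _ _ (1 * `|s *: v + u *: e|)); first exact: ler_wpM2r.
  rewrite mul1r (le_lt_trans (ler_normD _ _)) // !normrZ.
  apply: (@le_lt_trans _ _ (`|s| * N)); last by rewrite -ltr_pdivlMr.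
  have := normr_ge0 v; have := normr_ge0 e; have := normr_ge0 s; rewrite /N; nra.
have ball_pt s u : `|s| < eps -> `|u| <= `|s| -> `|pt s u - q| < r.
  move=> se us; rewrite /pt addrC addKr -[X in `|X|]scale1r.
  by apply: pt_in => //; rewrite normr1.
have convex_ball z z' t : 0 <= t <= 1 -> `|z - q| < r -> `|z' - q| < r ->
    `|z + t *: (z' - z) - q| < r.
  move=> /andP[t0 t1] zr z'r.
  have -> : z + t *: (z' - z) - q = (1 - t) *: (z - q) + t *: (z' - q).
    rewrite scalerBl scale1r [in RHS]addrAC -[in RHS]addrA -scalerBr opprB addrA subrK.
    by rewrite addrAC.
  rewrite (le_lt_trans (ler_normD _ _)) // !normrZ (ger0_norm t0) ger0_norm ?subr_ge0 //.
  have [th|th] := leP t (1 / 2); nra.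
have mean z z' a b : `|z - q| < r -> `|z' - q| < r -> z' - z = a *: v + b *: e ->
    exists y, [/\ `|y - q| < r, `|y - z| <= `|z' - z| &
      f z' - f z = a * 'D_v f y + b * 'D_e f y].
  move=> zr z'r zz'.
  have [|t t01] := @segment_mean_value f z (z' - z).
    by move=> t t01; apply: df; have [] := rP _ (convex_ball _ _ _ t01 zr z'r).
  have yr := convex_ball _ _ _ t01 zr z'r; have [Uy _ _] := rP _ yr.
  rewrite [z + (z' - z)]addrC subrK => ->; exists (z + t *: (z' - z)); split=> //.
    rewrite addrC addKr normrZ; case/andP: t01 => t0 t1.
    by rewrite ger0_norm // ler_piMl.
  by rewrite [X in 'D_X _ _]zz' derive_lin //; exact: df.
have q_in : `|q - q| < r by rewrite subrr normr0.
have sol s : `|s| < eps -> exists2 u, `|u| <= `|s| & f (pt s u) = 0.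
  move=> se; have s0 := normr_ge0 s.
  have ptq u : pt s u - q = s *: v + u *: e by rewrite /pt addrC addKr.
  have fpt u : `|u| <= `|s| -> exists y, 
      [/\ 1 / 2 < 'D_e f y, `|'D_v f y| < 1 / 4 & f (pt s u) = s * 'D_v f y + u * 'D_e f y].
    move=> us; have [y [/rP[_ ey vy] _ Ey]] := mean q _ s u q_in (ball_pt _ _ se us) (ptq u).
    by exists y; split => //; rewrite -Ey fq subr0.
  have sv y : `|'D_v f y| < 1 / 4 -> `|s * 'D_v f y| <= `|s| * (1 / 4).
    by move=> vy; rewrite normrM ler_wpM2l // ltW.
  have pos : 0 <= f (pt s `|s|).
    have [|y [ey vy ->]] := fpt `|s|; first by rewrite normr_id.
    have := sv _ vy; rewrite ler_norml => /andP[]; nra.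
  have neg : f (pt s (- `|s|)) <= 0.
    have [|y [ey vy ->]] := fpt (- `|s|); first by rewrite normrN normr_id.
    have := sv _ vy; rewrite ler_norml => /andP[]; nra.
  have [|||u] := @IVT R (fun u => f (pt s u)) (- `|s|) `|s| 0; first by lra.
  - apply: derivable_within_continuous => u; rewrite in_itv/= -ler_norml => us.
    have [Upt _ _] := rP _ (ball_pt _ _ se us).
    have := @is_derive_along f (fun u => pt s u) u e (df _ Upt).
    rewrite /pt; have -> : (fun u => q + (s *: v + u *: e)) = (fun u => (q + s *: v) + u *: e).
      by apply/funext => u'; rewrite addrA.
    move=> /(_ (is_derive_line _ _ _)); case=> dfu _.
    rewrite (_ : (fun u => f _) = f \o (fun u => q + s *: v + u *: e)) //.
    by apply/funext => u' /=; rewrite addrA.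
  - by rewrite ge_min neg le_max pos orbT.
  by rewrite in_itv/= -ler_norml => us fu; exists u.
pose g s : R := if pselect (`|s| < eps) is left h then s2val (cid2 (sol s h)) else 0.
have gP s : `|s| < eps -> `|g s| <= `|s| /\ f (pt s (g s)) = 0.
  by move=> h; rewrite /g; case: pselect => // h'; case: cid2.
pose c s := pt s (g s).
pose psi z := - ('D_v f z / 'D_e f z).
have c_in s : `|s| < eps -> `|c s - q| < r.
  by move=> se; apply: ball_pt => //; have [] := gP s se.
(* The implicit relation between two solutions, solved for the increment of g. *)
have slope s s' : `|s| < eps -> `|s'| < eps -> exists y,
    [/\ `|y - q| < r, `|y - c s| <= `|c s' - c s| & g s' - g s = (s' - s) * psi y].
  move=> se s'e; have [_ fs] := gP s se; have [_ fs'] := gP s' s'e.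
  have [|y [yr yc]] := mean (c s) (c s') (s' - s) (g s' - g s) (c_in _ se) (c_in _ s'e).
    rewrite /c /pt opprD addrACA subrr add0r opprD addrACA !scalerBl.
    by rewrite addrACA.
  rewrite fs fs' subrr => E; exists y; split => //.
  have [_ ey _] := rP _ yr.
  have ey0 : 'D_e f y != 0 by rewrite gt_eqF //; lra.
  apply: (mulIf ey0); rewrite /psi mulrN mulNr -[in RHS]mulrA divfK //.
  by apply/eqP; rewrite -subr_eq0 opprK addrC E.
have cpsi z : `|z - q| < r -> {for z, continuous psi}.
  move=> zr; have [Uz ez _] := rP _ zr.
  apply: continuousN; apply: continuousM; first exact: cf.
  by apply: continuousV; [rewrite gt_eqF //; lra|exact: cf].
have psi_le y : `|y - q| < r -> `|psi y| <= 1.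
  move=> /rP[_ ey vy]; have ey0 : 0 < 'D_e f y by lra.
  rewrite normrN normrM normfV (gtr0_norm ey0) ler_pdivrMr //; lra.
have g_lip s s' : `|s| < eps -> `|s'| < eps -> `|g s' - g s| <= `|s' - s|.
  move=> se s'e; have [y [yr _ ->]] := slope _ _ se s'e.
  by rewrite normrM ler_piMr // psi_le.
have c_lip s s' : `|s| < eps -> `|s'| < eps -> `|c s' - c s| <= N * `|s' - s|.
  move=> se s'e.
  have -> : c s' - c s = (s' - s) *: v + (g s' - g s) *: e.
    by rewrite /c /pt opprD addrACA subrr add0r opprD addrACA !scalerBl.
  rewrite (le_trans (ler_normD _ _)) // !normrZ.
  have := g_lip _ _ se s'e; have := normr_ge0 v; have := normr_ge0 e.
  have := normr_ge0 (s' - s); rewrite /N; nra.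
have near_eps (s : R) : `|s| < eps -> \forall s' \near s, `|s'| < eps.
  by move=> se; exact: (@cvgr_norm_lt _ _ _ _ _ (fun x : R => x) s cvg_id).
have dg (s : R) : `|s| < eps -> is_derive s 1 g (psi (c s)).
  move=> se.
  have h : (fun h => h^-1 *: ((g \o shift s) (h *: 1) - g s)) @ 0^' --> psi (c s).
    apply/cvgrPdist_lt => d d0.
    have /cvgr_dist_lt /(_ _ d0) /nbhs_normP[k /= k0 kP] := cpsi _ (c_in _ se).
    near=> h.
    have h0 : h != 0 by near: h; exact: nbhs_dnbhs_neq.
    have he : `|h + s| < eps.
      near: h; apply: (@cvg_within _ (nbhs (0 : R))).
      have := near_eps s se; rewrite (near_shift 0).
      by apply: filterS => x /=; rewrite subr0.
    have hk : `|h| < k / N by near: h; apply: dnbhs0_lt; rewrite divr_gt0.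
    rewrite /= [h *: 1]mulr1.
    have [y [_ yc ->]] := slope s (h + s) se he.
    rewrite addrK [_ *: _]mulrA mulVf // mul1r; apply: kP => /=.
    rewrite distrC (le_lt_trans yc) // (le_lt_trans (c_lip _ _ se he)) //.
    by rewrite addrK mulrC -ltr_pdivlMr.
  by apply: DeriveDef; [apply/cvg_ex; eexists; exact: h|exact: cvg_lim h].
have dc (s : R) : `|s| < eps -> is_derive s 1 c (v + psi (c s) *: e).
  move=> se; rewrite /c /pt.
  have dge : is_derive s 1 (fun s => g s *: e) (psi (c s) *: e).
    by apply: is_derive_scalel; exact: dg.
  have -> : (fun s => q + (s *: v + g s *: e)) = (fun s => q + s *: v) + (fun s => g s *: e).
    by apply/funext => s'; rewrite /= addrA.
  by apply: is_deriveD => //; exact: is_derive_line.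
have dc1 (s : R) : `|s| < eps -> derive1 c s = v + psi (c s) *: e.
  by move=> se; rewrite derive1E; have [] := dc s se.
have c0 : c 0 = q.
  have [] := gP 0; first by rewrite normr0.
  rewrite normr0 normr_le0 => /eqP g0 _.
  by rewrite /c /pt g0 !scale0r !addr0.
exists c, eps; split => //.
  by rewrite dc1 ?normr0 // c0 /psi Dv mul0r oppr0 scale0r addr0.
move=> s se; have [Uc _ _] := rP _ (c_in _ se); have [cd _] := dc s se.
split => //; first by have [] := gP s se.
have cc : {for s, continuous c}.
  by apply: differentiable_continuous; exact/derivable1_diffP.
rewrite /prop_for /continuous_at dc1 //.
apply: (@cvg_trans _ ((fun s => v + psi (c s) *: e) @ s)).
  by apply: near_eq_cvg; near=> s'; rewrite dc1 //; near: s'; exact: near_eps.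
have h1 : (fun _ : R => v) @ s --> v by exact: cvg_cst.
have h2 : (fun s => psi (c s)) @ s --> psi (c s).
  by apply: (@continuous_comp _ _ _ c psi) => //; exact/cpsi/c_in.
exact: cvgD h1 (cvgZr_tmp h2).
Unshelve. all: by end_near. Qed.

End Implicit.

(** * The metric and the horizontal distribution *)

Section HeisenbergAlgebra.
Context {R : realType} {n : nat}.
Implicit Types (p q v w : heis R n).

Lemma Xcoef_lin (a : R) v w i : Xcoef (a *: v + w) i = a * Xcoef v i + Xcoef w i.
Proof. by rewrite /Xcoef /= !mxE. Qed.

Lemma Ycoef_lin (a : R) v w i : Ycoef (a *: v + w) i = a * Ycoef v i + Ycoef w i.
Proof. by rewrite /Ycoef /= !mxE. Qed.

Lemma Tcoef_lin p (a : R) v w : Tcoef p (a *: v + w) = a * Tcoef p v + Tcoef p w.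
Proof.
rewrite /Tcoef mulrBr addrACA -opprD mulr_sumr -big_split /=; congr (_ - _).
by apply: eq_bigr => i _; rewrite !mxE; ring.
Qed.

Lemma metricC p v w : metric p v w = metric p w v.
Proof.
rewrite /metric [in RHS]mulrC; congr (_ + _); apply: eq_bigr => i _; ring.
Qed.

Lemma metric_lin p u (a : R) v w :
  metric p u (a *: v + w) = a * metric p u v + metric p u w.
Proof.
rewrite /metric Tcoef_lin.
have -> : \sum_i (Xcoef u i * Xcoef (a *: v + w) i + Ycoef u i * Ycoef (a *: v + w) i) =
    a * (\sum_i (Xcoef u i * Xcoef v i + Ycoef u i * Ycoef v i)) +
    \sum_i (Xcoef u i * Xcoef w i + Ycoef u i * Ycoef w i).
  rewrite mulr_sumr -big_split /=; apply: eq_bigr => i _.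
  by rewrite Xcoef_lin Ycoef_lin; ring.
by ring.
Qed.

Lemma metricZ p u (a : R) v : metric p u (a *: v) = a * metric p u v.
Proof.
have m0 : metric p u 0 = 0.
  by have := metric_lin p u (-1) 0 0; rewrite scaler0 addr0 mulN1r addNr.
by rewrite -[a *: v]addr0 metric_lin m0 addr0.
Qed.

Lemma metricD p u v w : metric p u (v + w) = metric p u v + metric p u w.
Proof. by rewrite -[v]scale1r metric_lin mul1r scale1r. Qed.

Lemma metricB p u v w : metric p u (v - w) = metric p u v - metric p u w.
Proof. by rewrite metricD -scaleN1r metricZ mulN1r. Qed.

Lemma Tcoef_metric p v : metric p v Tfield = Tcoef p v.
Proof.
rewrite /metric Tcoef_Tfield mulr1 big1 ?add0r // => i _.
by rewrite /Xcoef /Ycoef /= !mxE !mulr0 addr0.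
Qed.

Lemma horizontalP p v : horizontal p v <-> Tcoef p v = 0.
Proof.
split=> [[a [b ->]]|T0]; last first.
  exists (Xcoef v), (Ycoef v).
  by rewrite [LHS](frame_expansion p) T0 scale0r addr0.
rewrite -Tcoef_metric metricC; elim: (index_enum _) => [|i r IH].
  by rewrite big_nil -(scale0r 0) metricZ mul0r.
rewrite big_cons -addrA metric_lin metric_lin IH.
have [_ _ _ [XT YT] _] := metric_frame p i i.
by rewrite metricC XT metricC YT !mulr0 !addr0.
Qed.

Lemma metric_ge0 p v : 0 <= metric p v v.
Proof.
by rewrite addr_ge0 ?sumr_ge0 -?expr2 ?sqr_ge0 // => i _; rewrite addr_ge0 // -expr2 sqr_ge0.
Qed.

Lemma metric_eq0 p v : metric p v v = 0 -> v = 0.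
Proof.
move=> /eqP; rewrite paddr_eq0 -?expr2 ?sqr_ge0 //; last first.
  by apply: sumr_ge0 => i _; rewrite -!expr2 addr_ge0 ?sqr_ge0.
rewrite expf_eq0 /= => /andP[/eqP s0 /eqP T0].
have XY i : Xcoef v i = 0 /\ Ycoef v i = 0.
  have : Xcoef v i * Xcoef v i + Ycoef v i * Ycoef v i = 0.
    apply: (psumr_eq0P _ s0) => // j _; by rewrite -!expr2 addr_ge0 ?sqr_ge0.
  by move=> /eqP; rewrite -!expr2 paddr_eq0 ?sqr_ge0 // !expf_eq0 /= => /andP[/eqP ? /eqP].
rewrite (frame_expansion p v) T0 scale0r addr0 big1 // => i _.
by have [-> ->] := XY i; rewrite !scale0r addr0.
Qed.

Lemma metric_inj p v w : (forall u, metric p v u = metric p w u) -> v = w.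
Proof.
move=> vw; apply/eqP; rewrite -subr_eq0; apply/eqP/(@metric_eq0 p).
have h u : metric p (v - w) u = 0.
  by rewrite metricC metricB !(metricC p u) vw subrr.
exact: h.
Qed.

Lemma hproj_decomp p (m l : R) v : horizontal p v ->
  hproj p (m *: (v + l *: Tfield)) = m *: v.
Proof.
move=> /horizontalP T0.
have TT : metric p Tfield Tfield = 1 :> R by rewrite Tcoef_metric Tcoef_Tfield.
rewrite /hproj [metric _ _ _]metricC metricZ metricD metricZ TT.
rewrite metricC Tcoef_metric T0 add0r mulr1 scalerDr scalerA.
by rewrite addrK.
Qed.

Lemma mnormZ p (m : R) v : 0 <= m -> mnorm p (m *: v) = m * mnorm p v.
Proof.
move=> m0; rewrite /mnorm metricZ metricC metricZ mulrA -expr2.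
by rewrite sqrtrM ?sqr_ge0 // sqrtr_sqr ger0_norm.
Qed.

(** [Tfield] is orthogonal to horizontal vectors, so that the horizontal part of [N q]
is [m *: v] and the factor [m] cancels in both quotients. *)
Lemma normal_of_direction (N : heis R n -> heis R n) q (m l : R) v :
  horizontal q v -> mnorm q v = 1 -> 0 < m -> N q = m *: (v + (l / 2) *: Tfield) ->
  horizontal_normal N q = v /\ normal_curvature N q = l.
Proof.
move=> hv v1 m0 Nq; have m_neq0 : m != 0 by rewrite gt_eqF.
rewrite /horizontal_normal /normal_curvature Nq hproj_decomp // mnormZ ?ltW // v1 mulr1.
split; first by rewrite scalerA mulVf // scale1r.
rewrite metricC metricZ metricD metricZ metricC Tcoef_metric.
rewrite ((horizontalP _ _).1 hv) Tcoef_metric Tcoef_Tfield.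
by field.
Qed.

Lemma mnorm_hproj p v :
  mnorm p (hproj p v) = Num.sqrt (\sum_i (Xcoef v i ^+ 2 + Ycoef v i ^+ 2)).
Proof.
have T0 : Tcoef p (hproj p v) = 0.
  rewrite /hproj addrC -scaleNr Tcoef_lin Tcoef_metric Tcoef_Tfield mulr1.
  exact: addNr.
rewrite /mnorm /metric T0 mulr0 addr0; congr Num.sqrt.
apply: eq_bigr => i _; rewrite !expr2.
have -> : Xcoef (hproj p v) i = Xcoef v i.
  by rewrite /hproj addrC -scaleNr Xcoef_lin {1}/Xcoef /= mxE mulr0 add0r.
have -> // : Ycoef (hproj p v) i = Ycoef v i.
by rewrite /hproj addrC -scaleNr Ycoef_lin {1}/Ycoef /= mxE mulr0 add0r.
Qed.

End HeisenbergAlgebra.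

(** * Length and distance *)

Section PointwiseRules.
Context {R : realType}.
Implicit Types (f g : R -> R) (t : R).

Lemma is_derive_add f g t (f' g' : R) : is_derive t 1 f f' -> is_derive t 1 g g' ->
  is_derive t 1 (fun s => f s + g s) (f' + g').
Proof. by move=> df dg; exact: is_deriveD. Qed.

Lemma is_derive_mul f g t (f' g' : R) : is_derive t 1 f f' -> is_derive t 1 g g' ->
  is_derive t 1 (fun s => f s * g s) (f' * g t + f t * g').
Proof.
move=> df dg; have h := is_deriveM df dg.
by apply: (is_derive_eq h); rewrite addrC [_ *: f']mulrC.
Qed.

Lemma is_derive_opp f t (f' : R) : is_derive t 1 f f' -> is_derive t 1 (fun s => - f s) (- f').
Proof. by move=> df; exact: is_deriveN. Qed.

Lemma is_derive_const (a : R) t : is_derive t 1 (fun=> a) 0.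
Proof. exact: is_derive_cst. Qed.

Lemma is_derive_var t : is_derive t 1 (fun s : R => s) 1.
Proof. exact: is_derive_id. Qed.

Lemma is_derive_bigsum (I : Type) (r : seq I) (F : I -> R -> R) (F' : I -> R) (t : R) :
  (forall i, is_derive t 1 (F i) (F' i)) ->
  is_derive t 1 (fun s => \sum_(i <- r) F i s) (\sum_(i <- r) F' i).
Proof.
move=> dF; elim: r => [|i r IH].
  rewrite big_nil (_ : (fun _ => _) = fun=> 0); first exact: is_derive_cst.
  by apply/funext => s; rewrite big_nil.
rewrite big_cons (_ : (fun _ => _) = fun s => F i s + \sum_(i <- r) F i s).
  exact: is_derive_add.
by apply/funext => s; rewrite big_cons.
Qed.

End PointwiseRules.

Ltac derive_rules := repeat first
  [ eassumption
  | apply: is_derive_const | apply: is_derive_var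
  | apply: is_derive_add | apply: is_derive_mul | apply: is_derive_opp
  | apply: is_derive_bigsum => ?
  | apply: smooth_is_derive; solve [eauto using smooth_derive1] ].

Ltac smooth_rules := repeat first
  [ eassumption | solve [eauto]
  | apply: smooth_cst | apply: smooth_id
  | apply: smoothD | apply: smoothM | apply: smoothN
  | apply: smooth_sum => ? | apply: smooth_derive1 ].

Section Length.
Context {R : realType} {n : nat}.

(** The continuous function [F] expresses the speed and makes it integrable; the
bound by a derivative turns an integral estimate into values at the ends. *)
Lemma curve_length_le (c : R -> heis R n) (d : R) (F W : R -> R) :
  0 < d -> continuous F -> smooth W ->
  (forall t, t \in `[0, d] -> mnorm (c t) (itv_derive 0 d c t) = F t) ->
  (forall t, t \in `[0, d] -> F t <= derive1 W t) ->
  curve_length 0 d c <= W d - W 0.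
Proof.
move=> d0 cF sW cE FW.
have cW' : continuous (derive1 W) by apply: smooth_continuous; exact: smooth_derive1.
have int h : continuous h -> lebesgue_measure.-integrable `[0, d] (EFin \o h).
  move=> ch; apply: continuous_compact_integrable; first exact: segment_compact.
  exact: continuous_subspaceT.
have -> : curve_length 0 d c = \int[lebesgue_measure]_(t in `[0, d]) F t.
  by apply: eq_Rintegral => t; rewrite inE => td; exact: cE.
apply: (@le_trans _ _ (\int[lebesgue_measure]_(t in `[0, d]) derive1 W t)).
  apply: le_Rintegral => //; [exact: int|exact: int].
rewrite /Rintegral (@continuous_FTC2 _ (derive1 W) W) //.
- exact: continuous_subspaceT.
- have cW := smooth_continuous sW; split.
  + by move=> t _; exact: smooth_derivable.
  + by apply: cvg_at_right_filter; exact: cW.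
  + by apply: cvg_at_left_filter; exact: cW.
Qed.

Lemma cc_dist_le (p q : heis R n) (c : R -> heis R n) (d l : R) :
  0 < d -> smooth c -> c 0 = p -> c d = q ->
  (forall t, t \in `[0, d] -> horizontal (c t) (derive1 c t)) ->
  curve_length 0 d c <= l -> cc_dist p q <= l.
Proof.
move=> d0 sc c0 cd hc; apply: le_trans.
apply: ge_inf; last first.
  exists 0, d, c; split => //; exists [:: d].
    by split=> //=; rewrite d0.
  move=> [|//] _ /=; split; first by exists c => //; exact: derivable_derive1n.
  move=> t td; rewrite (itv_deriveE d0 td (g := c) _ (smooth_is_derive t sc)) //.
  exact: hc.
exists 0 => l' [a [b [c' [_ _ _ ->]]]].
by apply: Rintegral_ge0 => t _; exact: sqrtr_ge0.
Qed.

Lemma inf_ge0 (S : set R) : (forall x, S x -> 0 <= x) -> 0 <= inf S.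
Proof.
move=> S0; have [->|/set0P Sn0] := eqVneq S set0; first by rewrite inf0.
exact: lb_le_inf.
Qed.

Lemma cc_dist_ge0 (p q : heis R n) : 0 <= cc_dist p q.
Proof.
apply: inf_ge0 => _ [a [b [c [_ _ _ ->]]]].
by apply: Rintegral_ge0 => t _; exact: sqrtr_ge0.
Qed.

Lemma dist_to_ge0 (E : set (heis R n)) p : 0 <= dist_to E p.
Proof. by apply: inf_ge0 => _ [q _ <-]; exact: cc_dist_ge0. Qed.

Lemma dist_to_le (E : set (heis R n)) p q : E q -> dist_to E p <= cc_dist p q.
Proof.
move=> Eq; apply: ge_inf; last by exists q.
by exists 0 => _ [z _ <-]; exact: cc_dist_ge0.
Qed.

End Length.

(** * Variations of a geodesic with one end fixed *)

(** The tangent line of the square root at 1. It bounds the length by the energy,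
to first order sharply at unit speed, in place of a differentiation under the
integral sign. *)
Lemma sqrtr_le_half_succ (R : realType) (m : R) : 0 <= m -> Num.sqrt m <= (m + 1) / 2.
Proof.
move=> m0; have := sqr_ge0 (Num.sqrt m - 1).
by rewrite sqrrB1 sqr_sqrtr // mulr2n; lra.
Qed.

Section Variation.
Context {R : realType} {n : nat}.
(* The coordinates of a geodesic that is run backwards: it reaches the point which
   will be moved at time d, and its curvature is - lambda. *)
Variables (u w : 'I_n -> R -> R) (z : R -> R) (d lambda : R).
Hypothesis d0 : 0 < d.
Hypotheses (su : forall i, smooth (u i)) (sw : forall i, smooth (w i)) (sz : smooth z).
Hypothesis contact : forall t, t \in `[0, d] ->
  derive1 z t = \sum_i (derive1 (u i) t * w i t - derive1 (w i) t * u i t).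
Hypothesis speed : forall t, t \in `[0, d] ->
  \sum_i (derive1 (u i) t ^+ 2 + derive1 (w i) t ^+ 2) = 1.
Hypothesis geod_u : forall t, t \in `[0, d] -> forall i,
  derive1 (derive1 (u i)) t = - lambda * derive1 (w i) t.
Hypothesis geod_w : forall t, t \in `[0, d] -> forall i,
  derive1 (derive1 (w i)) t = lambda * derive1 (u i) t.

Section Fields.
Variables (a b : 'I_n -> R -> R) (P : R -> R).
Hypotheses (sa : forall i, smooth (a i)) (sb : forall i, smooth (b i)) (sP : smooth P).
Hypotheses (a0 : forall i, a i 0 = 0) (b0 : forall i, b i 0 = 0) (P0 : P 0 = 0).
Hypothesis dP : forall t, t \in `[0, d] ->
  derive1 P t = \sum_i (derive1 (u i) t * b i t - derive1 (w i) t * a i t).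

Let slope := \sum_i (derive1 (u i) d * a i d + derive1 (w i) d * b i d) - lambda * P d.

(** The variation by [s] has horizontal coordinates u + s a, w + s b. Its last
coordinate is then forced; since P' is the integrand u'.b - w'.a, it changes by
s (a.w - b.u + 2 P) + s^2 Q with Q' = a'.b - b'.a. The curve is exactly horizontal,
and only the quadratic term Q of the displacement of its end is left implicit. By
[sqrtr_le_half_succ] its length is at most d + s slope + s^2 B(d) / 2, where B is the
primitive of |a'|^2 + |b'|^2. *)
Lemma variation_shortens : slope < 0 -> exists K : R, \forall s \near 0^'+,
  cc_dist (curve u w z 0)
    (curve u w z d + s *: (curve a b (fun t => \sum_i (a i t * w i t - b i t * u i t) + 2 * P t) d)
      + (s ^+ 2 * K) *: Tfield) < d.
Proof.
move=> slope_lt0.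
pose q (t : R) := \sum_i (derive1 (a i) t * b i t - derive1 (b i) t * a i t).
pose e (t : R) := \sum_i (derive1 (a i) t ^+ 2 + derive1 (b i) t ^+ 2).
have sq : smooth q by rewrite /q; smooth_rules.
have se : smooth e.
  rewrite /e (_ : (fun _ => _) = fun t => \sum_i (derive1 (a i) t * derive1 (a i) t
    + derive1 (b i) t * derive1 (b i) t)); first by smooth_rules.
  by apply/funext => t; apply: eq_bigr => i _; rewrite !expr2.
have [Q [Q0 dQ]] := exists_primitive (smooth_continuous sq).
have [B [B0 dB]] := exists_primitive (smooth_continuous se).
have sQ := smooth_primitive sq dQ; have sB := smooth_primitive se dB.
exists (Q d).
have near_s : \forall s \near 0^'+, s * slope + s ^+ 2 * (B d / 2) < 0.
  pose k := `|B d| + 1; have k0 : 0 < k by rewrite ltr_wpDl.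
  near=> s.
  have s0 : 0 < s by near: s; exact: nbhs_right_gt.
  have sk : s < - slope / k by near: s; apply: nbhs_right_lt; rewrite divr_gt0 // oppr_gt0.
  rewrite expr2 -mulrA -mulrDr pmulr_rlt0 //.
  move: sk; rewrite ltr_pdivlMr // => sk.
  have := ler_norm (B d); have := normr_ge0 (B d); rewrite /k in sk *; nra.
near=> s; have s_small : s * slope + s ^+ 2 * (B d / 2) < 0 by near: s.
pose X i t := u i t + s * a i t; pose Y i t := w i t + s * b i t.
pose Z t := z t + (s * (\sum_i (a i t * w i t - b i t * u i t) + 2 * P t) + s * s * Q t).
pose W t := t + (s * (\sum_i (derive1 (u i) t * a i t + derive1 (w i) t * b i t)
   - lambda * P t) + s * s * (1 / 2) * B t).
have sX i : smooth (X i) by rewrite /X; smooth_rules.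
have sY i : smooth (Y i) by rewrite /Y; smooth_rules.
have sZ : smooth Z by rewrite /Z; smooth_rules.
have sW : smooth W by rewrite /W; smooth_rules.
have X' i t : derive1 (X i) t = derive1 (u i) t + s * derive1 (a i) t.
  rewrite [LHS]derive1E; apply: derive_val; rewrite /X.
  apply: is_derive_eq; first by derive_rules.
  by rewrite mul0r add0r.
have Y' i t : derive1 (Y i) t = derive1 (w i) t + s * derive1 (b i) t.
  rewrite [LHS]derive1E; apply: derive_val; rewrite /Y.
  apply: is_derive_eq; first by derive_rules.
  by rewrite mul0r add0r.
have Z' t : t \in `[0, d] -> derive1 Z t =
    \sum_i (derive1 (X i) t * Y i t - derive1 (Y i) t * X i t).
  move=> td; rewrite [LHS]derive1E.
  have -> : 'D_1 Z t = derive1 z t + (s * (\sum_i (derive1 (a i) t * w i t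
      + a i t * derive1 (w i) t - (derive1 (b i) t * u i t + b i t * derive1 (u i) t))
      + 2 * derive1 P t) + s * s * q t).
    apply: derive_val; rewrite /Z.
    apply: is_derive_eq; first by derive_rules.
    by rewrite /=; ring.
  rewrite contact // dP // /q !mulrDr !mulr_sumr -!big_split /=.
  by apply: eq_bigr => i _; rewrite X' Y' /X /Y; ring.
have W' t : t \in `[0, d] -> derive1 W t =
    (\sum_i (derive1 (X i) t ^+ 2 + derive1 (Y i) t ^+ 2) + 1) / 2.
  move=> td; rewrite [LHS]derive1E.
  have -> : 'D_1 W t = 1 + (s * (\sum_i (derive1 (derive1 (u i)) t * a i t
      + derive1 (u i) t * derive1 (a i) t + (derive1 (derive1 (w i)) t * b i t
      + derive1 (w i) t * derive1 (b i) t)) - lambda * derive1 P t)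
      + s * s * (1 / 2) * e t).
    apply: derive_val; rewrite /W.
    apply: is_derive_eq; first by derive_rules.
    by rewrite /=; ring.
  rewrite dP // /e.
  transitivity (((\sum_i (derive1 (u i) t ^+ 2 + derive1 (w i) t ^+ 2)) + 1) / 2 +
    (s * (\sum_i (derive1 (u i) t * derive1 (a i) t + derive1 (w i) t * derive1 (b i) t)) +
    s * s * (1 / 2) * \sum_i (derive1 (a i) t ^+ 2 + derive1 (b i) t ^+ 2))).
    rewrite speed // (_ : (1 + 1) / 2 = 1 :> R); last by field.
    congr (_ + (s * _ + _)); rewrite mulr_sumr -sumrB; apply: eq_bigr => i _.
    by rewrite geod_u // geod_w //; ring.
  have -> : \sum_i (derive1 (X i) t ^+ 2 + derive1 (Y i) t ^+ 2) =
    \sum_i (derive1 (u i) t ^+ 2 + derive1 (w i) t ^+ 2) +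
    (2 * s * (\sum_i (derive1 (u i) t * derive1 (a i) t + derive1 (w i) t * derive1 (b i) t)) +
    s * s * \sum_i (derive1 (a i) t ^+ 2 + derive1 (b i) t ^+ 2)).
    rewrite !mulr_sumr -!big_split /=; apply: eq_bigr => i _.
    by rewrite X' Y'; ring.
  by field.
pose c := curve X Y Z.
have c' t : derive1 c t = ((\row_i derive1 (X i) t, \row_i derive1 (Y i) t), derive1 Z t).
  rewrite derive1E; apply: derive_val.
  by apply: is_derive_curve => *; exact: smooth_is_derive.
have sc : smooth c by exact: smooth_curve.
have T0 t : t \in `[0, d] -> Tcoef (c t) (derive1 c t) = 0.
  move=> td; rewrite /Tcoef c' /= Z' // -sumrB big1 // => i _.
  by rewrite !mxE subrr.
pose F t := Num.sqrt (\sum_i (derive1 (X i) t ^+ 2 + derive1 (Y i) t ^+ 2)).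
have sF : smooth (fun t => \sum_i (derive1 (X i) t ^+ 2 + derive1 (Y i) t ^+ 2)).
  rewrite (_ : (fun _ => _) = fun t => \sum_i (derive1 (X i) t * derive1 (X i) t
    + derive1 (Y i) t * derive1 (Y i) t)); first by smooth_rules.
  by apply/funext => t; apply: eq_bigr => i _; rewrite !expr2.
have length_c : curve_length 0 d c <= W d - W 0.
  apply: (@curve_length_le _ _ c d F W) => //.
  - by move=> t; apply: continuous_comp; [exact: smooth_continuous|exact: sqrt_continuous].
  - move=> t td; rewrite (itv_deriveE d0 td (g := c) _ (smooth_is_derive t sc)) //.
    rewrite /mnorm /metric T0 // mulr0 addr0 /F; congr Num.sqrt.
    by apply: eq_bigr => i _; rewrite /Xcoef /Ycoef c' /= !mxE !expr2.
  - move=> t td; rewrite W' //; apply: sqrtr_le_half_succ.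
    by apply: sumr_ge0 => i _; rewrite addr_ge0 ?sqr_ge0.
have Wd : W d - W 0 < d.
  have -> : W d - W 0 = d + (s * slope + s ^+ 2 * (B d / 2)); last by rewrite gtrDl.
  have -> : W 0 = 0.
    rewrite /W B0 P0 big1; last by move=> i _; rewrite a0 b0 !mulr0 addr0.
    by ring.
  by rewrite /W /slope; field.
apply: le_lt_trans Wd; apply: (@cc_dist_le _ _ _ _ c d) => //.
- rewrite /c /curve; congr ((_, _), _); [apply/rowP => i; rewrite !mxE /X a0| |].
  + by rewrite mulr0 addr0.
  + by apply/rowP => i; rewrite !mxE /Y b0 mulr0 addr0.
  + rewrite /Z P0 Q0 big1 => [|i _]; last by rewrite a0 b0 !mul0r subr0.
    by rewrite /=; ring.
- rewrite /c /curve; congr ((_, _), _).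
  + by apply/rowP => i; rewrite !mxE mulr0 addr0.
  + by apply/rowP => i; rewrite !mxE mulr0 addr0.
  + by rewrite /Z /= ![_ *: _]mulrC; ring.
- by move=> t td; apply/horizontalP; exact: T0.
Unshelve. all: by end_near. Qed.

End Fields.

(** The ramp [h] creates the horizontal displacement (al, be). Adding a multiple of
the rotated velocity (- w', u') times [rho], which vanishes at both ends, does not
affect it, but adds to u'.b - w'.a a multiple of rho, because the speed is 1. The
integral of rho from 0 to d is d^3 / 6, which explains the constant [k]. *)
Lemma variation_in_direction (al be : 'I_n -> R) (tau : R) :
  \sum_i (derive1 (u i) d * al i + derive1 (w i) d * be i) - lambda * (tau / 2) < 0 ->
  exists K : R, \forall s \near 0^'+,
  cc_dist (curve u w z 0)
    (curve u w z d + s *: ((\row_i al i, \row_i be i),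
        \sum_i (al i * w i d - be i * u i d) + tau)
      + (s ^+ 2 * K) *: Tfield) < d.
Proof.
move=> slope_lt0; have d_neq0 : d != 0 by rewrite gt_eqF.
pose h t := d^-1 * t.
have sh : smooth h by rewrite /h; smooth_rules.
have sp : smooth (fun t => h t * \sum_i (derive1 (u i) t * be i - derive1 (w i) t * al i)).
  by smooth_rules.
have [P1 [P10 dP1]] := exists_primitive (smooth_continuous sp).
have sP1 := smooth_primitive sp dP1.
pose k := (tau / 2 - P1 d) * (6 / (d * (d * d))).
pose rho t := t * (d - t).
have srho : smooth rho by rewrite /rho; smooth_rules.
pose a i t := h t * al i - k * rho t * derive1 (w i) t.
pose b i t := h t * be i + k * rho t * derive1 (u i) t.
pose P t := P1 t + k * (d * (1 / 2) * (t * t) - 1 / 3 * (t * (t * t))).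
have sa i : smooth (a i) by rewrite /a; smooth_rules.
have sb i : smooth (b i) by rewrite /b; smooth_rules.
have sP : smooth P by rewrite /P; smooth_rules.
have ad i : a i d = al i by rewrite /a /h /rho subrr mulVf //; ring.
have bd i : b i d = be i by rewrite /b /h /rho subrr mulVf //; ring.
have Pd : P d = tau / 2 by rewrite /P /k; field.
have [|||t td||K KP] := @variation_shortens a b P sa sb sP.
- by move=> i; rewrite /a /h /rho; ring.
- by move=> i; rewrite /b /h /rho; ring.
- by rewrite /P P10; ring.
- rewrite [LHS]derive1E.
  have -> : 'D_1 P t = h t * (\sum_i (derive1 (u i) t * be i - derive1 (w i) t * al i))
      + k * rho t.
    apply: derive_val; rewrite /P.
    by apply: is_derive_eq; rewrite /GRing.scale /= /rho; field.
  rewrite -[X in _ + X]mulr1 -(speed td) !mulr_sumr -big_split /=.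
  by apply: eq_bigr => i _; rewrite /a /b; ring.
- by rewrite Pd; under eq_bigr => i _ do rewrite ad bd.
suff -> : ((\row_i al i, \row_i be i), \sum_i (al i * w i d - be i * u i d) + tau) =
  curve a b (fun t => \sum_i (a i t * w i t - b i t * u i t) + 2 * P t) d by exists K.
rewrite /curve Pd mulrC divfK //; congr ((_, _), _ + _).
- by apply/rowP => i; rewrite !mxE ad.
- by apply/rowP => i; rewrite !mxE bd.
- by apply: eq_bigr => i _; rewrite ad bd.
Qed.

End Variation.

(** * First variation of length along a geodesic *)

Section GeodesicVariation.
Context {R : realType} {n : nat}.
Implicit Types (p q v w D : heis R n).

Lemma XYcoef_frame p (a b : 'I_n -> R) (c : R) i :
  let v := \sum_j (a j *: Xfield j p + b j *: Yfield j p) + c *: Tfield in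
  Xcoef v i = a i /\ Ycoef v i = b i.
Proof.
have X0 : Xcoef (0 : heis R n) i = 0 by rewrite /Xcoef /= mxE.
have Y0 : Ycoef (0 : heis R n) i = 0 by rewrite /Ycoef /= mxE.
split.
- have XD (x y : heis R n) : Xcoef (x + y) i = Xcoef x i + Xcoef y i by rewrite /Xcoef /= mxE.
  rewrite XD (big_morph (fun v : heis R n => Xcoef v i) XD X0) (bigD1 i) //= big1 => [|j ji].
    by rewrite /Xcoef /= !mxE !eqxx /=; ring.
  by rewrite /Xcoef /= !mxE eq_sym (negbTE ji) andbF /=; ring.
- have YD (x y : heis R n) : Ycoef (x + y) i = Ycoef x i + Ycoef y i by rewrite /Ycoef /= mxE.
  rewrite YD (big_morph (fun v : heis R n => Ycoef v i) YD Y0) (bigD1 i) //= big1 => [|j ji].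
    by rewrite /Ycoef /= !mxE !eqxx /=; ring.
  by rewrite /Ycoef /= !mxE eq_sym (negbTE ji) andbF /=; ring.
Qed.

Lemma JmapE p v : Jmap p v =
  \sum_j (- Ycoef v j *: Xfield j p + Xcoef v j *: Yfield j p) + 0 *: Tfield.
Proof. by rewrite scale0r addr0; apply: eq_bigr => j _; rewrite addrC scaleNr. Qed.

Lemma is_derive_Xcoef (c : R -> heis R n) (t : R) v i :
  is_derive t 1 c v -> is_derive t 1 (fun s => Xcoef (c s) i) (Xcoef v i).
Proof. by move=> dc; apply/is_derive_entry/is_derive_fst/is_derive_fst. Qed.

Lemma is_derive_Ycoef (c : R -> heis R n) (t : R) v i :
  is_derive t 1 c v -> is_derive t 1 (fun s => Ycoef (c s) i) (Ycoef v i).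
Proof. by move=> dc; apply/is_derive_entry/is_derive_snd/is_derive_fst. Qed.

(** The point [gamma 0] can be moved with any velocity [D], while [gamma d] is kept:
[Tcoef] of the displacement is prescribed by tau in [variation_in_direction], and the
slope there is [- metric (gamma 0) Z D], because reversing time changes the sign of
the velocity. *)
Lemma geodesic_first_variation (gamma : R -> heis R n) (d lambda : R) :
  0 < d -> geodesic 0 d lambda gamma ->
  let v := itv_derive 0 d gamma 0 in
  [/\ horizontal (gamma 0) v, mnorm (gamma 0) v = 1 &
    forall D, 0 < metric (gamma 0) (v + (lambda / 2) *: Tfield) D ->
      exists K : R, \forall s \near 0^'+,
        cc_dist (gamma d) (gamma 0 + s *: D + (s ^+ 2 * K) *: Tfield) < d].
Proof.
move=> d0 [[g dg gE] hor spd geo] v.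
have sg : smooth g by split.
have iE t : t \in `[0, d] -> itv_derive 0 d gamma t = derive1 g t.
  by move=> td; rewrite (itv_deriveE d0 td gE (smooth_is_derive t sg)).
have in0 : (0 : R) \in `[0, d] by rewrite in_itv/= lexx ltW.
have ind : d \in `[0, d] by rewrite in_itv/= lexx ltW.
split; [exact: hor|exact: spd|].
have g0 : gamma 0 = g 0 by rewrite gE.
have gd : gamma d = g d by rewrite gE.
rewrite {}/v iE // g0 gd => D; set v := derive1 g 0 => Dpos.
pose x i t := (g t).1.1 0 i; pose y i t := (g t).1.2 0 i.
have [sx sy st] := smooth_coordinates sg.
have [sx' sy' _] := smooth_coordinates (smooth_derive1 sg).
have x' i t : derive1 (x i) t = Xcoef (derive1 g t) i.
  by rewrite derive1E; apply/derive_val/is_derive_Xcoef/smooth_is_derive.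
have y' i t : derive1 (y i) t = Ycoef (derive1 g t) i.
  by rewrite derive1E; apply/derive_val/is_derive_Ycoef/smooth_is_derive.
have z' t : derive1 (fun s => (g s).2) t = (derive1 g t).2.
  by rewrite derive1E; apply/derive_val/is_derive_snd/smooth_is_derive.
have solve_J (a b l a' b' : R) : l * (- b) + a' = 0 -> l * a + b' = 0 ->
    a' = l * b /\ b' = - l * a.
  by move=> h1 h2; split; lra.
have geo_eq t i : t \in `[0, d] ->
    derive1 (derive1 (x i)) t = lambda * derive1 (y i) t /\
    derive1 (derive1 (y i)) t = - lambda * derive1 (x i) t.
  move=> td; have := geo t td.
  have dX j : itv_derive 0 d (fun s => Xcoef (itv_derive 0 d gamma s) j) t
      = derive1 (derive1 (x j)) t.
    apply: (itv_deriveE d0 td (g := derive1 (x j))).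
      by move=> s sd; rewrite x' iE.
    exact/smooth_is_derive/smooth_derive1/sx.
  have dY j : itv_derive 0 d (fun s => Ycoef (itv_derive 0 d gamma s) j) t
      = derive1 (derive1 (y j)) t.
    apply: (itv_deriveE d0 td (g := derive1 (y j))).
      by move=> s sd; rewrite y' iE.
    exact/smooth_is_derive/smooth_derive1/sy.
  rewrite JmapE addrC => eq0.
  have [X0 Y0] : Xcoef (0 : heis R n) i = 0 /\ Ycoef (0 : heis R n) i = 0.
    by rewrite /Xcoef /Ycoef /= !mxE.
  move: X0 Y0; rewrite -eq0 Xcoef_lin Ycoef_lin.
  rewrite /cov_derive !(XYcoef_frame _ _ _ _ _).1 !(XYcoef_frame _ _ _ _ _).2.
  rewrite dX dY iE // -x' -y'; exact: solve_J.
pose u i t := x i (d - t); pose w i t := y i (d - t); pose z t := (g (d - t)).2.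
have su i : smooth (u i) by exact: smooth_reverse (sx i).
have sw i : smooth (w i) by exact: smooth_reverse (sy i).
have sz : smooth z by exact: smooth_reverse st.
have rev1 (f : R -> R) t : smooth f ->
    derive1 (fun s => f (d - s)) t = - derive1 f (d - t).
  move=> sf; rewrite derive1E; apply: derive_val.
  by apply: is_derive_reverse; exact: smooth_derivable.
have rev2 (f : R -> R) t : smooth f ->
    derive1 (derive1 (fun s => f (d - s))) t = derive1 (derive1 f) (d - t).
  move=> sf; have -> : derive1 (fun s => f (d - s)) = fun s => - derive1 f (d - s).
    by apply/funext => s; rewrite rev1.
  rewrite derive1E; apply: derive_val.
  rewrite -[X in is_derive _ _ _ X]opprK; apply: is_derive_opp.
  by apply: is_derive_reverse; apply: smooth_derivable; exact: smooth_derive1.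
have rev_in t : t \in `[0, d] -> d - t \in `[0, d].
  by rewrite !in_itv/= => /andP[? ?]; apply/andP; split; lra.
have T0 t : t \in `[0, d] -> Tcoef (g t) (derive1 g t) = 0.
  by move=> td; apply/horizontalP; rewrite -iE // gE //; exact: hor.
have u' i t : derive1 (u i) t = - Xcoef (derive1 g (d - t)) i by rewrite -x'; exact: rev1 (sx i).
have w' i t : derive1 (w i) t = - Ycoef (derive1 g (d - t)) i by rewrite -y'; exact: rev1 (sy i).
have contact t : t \in `[0, d] ->
    derive1 z t = \sum_i (derive1 (u i) t * w i t - derive1 (w i) t * u i t).
  move=> td; rewrite [LHS](rev1 _ t st) z'.
  have /eqP := T0 _ (rev_in _ td); rewrite subr_eq0 => /eqP ->.
  rewrite -sumrN; apply: eq_bigr => i _.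
  by rewrite u' w' /Xcoef /Ycoef /u /w /x /y; ring.
have speed t : t \in `[0, d] -> \sum_i (derive1 (u i) t ^+ 2 + derive1 (w i) t ^+ 2) = 1.
  move=> td; have rtd := rev_in _ td; have := spd _ rtd.
  rewrite -gE // iE // /mnorm => /(congr1 (fun r : R => r ^+ 2)).
  rewrite expr1n sqr_sqrtr ?metric_ge0 // /metric T0 // mulr0 addr0 => <-.
  by apply: eq_bigr => i _; rewrite u' w'; ring.
have geod_u t : t \in `[0, d] -> forall i,
    derive1 (derive1 (u i)) t = - lambda * derive1 (w i) t.
  move=> td i; by rewrite [LHS](rev2 (x i) t (sx i)) (geo_eq _ i (rev_in _ td)).1 w' y'; ring.
have geod_w t : t \in `[0, d] -> forall i,
    derive1 (derive1 (w i)) t = lambda * derive1 (u i) t.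
  move=> td i; by rewrite [LHS](rev2 (y i) t (sy i)) (geo_eq _ i (rev_in _ td)).2 u' x'; ring.
have slope : \sum_i (derive1 (u i) d * Xcoef D i + derive1 (w i) d * Ycoef D i)
    - lambda * (Tcoef (g 0) D / 2) < 0.
  move: Dpos; rewrite metricC metricD metricZ Tcoef_metric metricC /metric.
  rewrite T0 // mul0r addr0 => Dpos.
  have -> : \sum_i (derive1 (u i) d * Xcoef D i + derive1 (w i) d * Ycoef D i)
      = - \sum_i (Xcoef v i * Xcoef D i + Ycoef v i * Ycoef D i).
    by rewrite -sumrN; apply: eq_bigr => i _; rewrite u' w' subrr; ring.
  by rewrite /v in Dpos *; lra.
have [K KP] := variation_in_direction d0 su sw sz contact speed geod_u geod_w slope.
exists K; move: KP; apply: filterS => s.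
have -> : curve u w z 0 = g d.
  rewrite /curve /u /w /z /x /y subr0.
  by rewrite [RHS]surjective_pairing [(g d).1]surjective_pairing; congr ((_, _), _);
    apply/rowP => i; rewrite mxE.
have -> : curve u w z d = g 0.
  rewrite /curve /u /w /z /x /y subrr.
  by rewrite [RHS]surjective_pairing [(g 0).1]surjective_pairing; congr ((_, _), _);
    apply/rowP => i; rewrite mxE.
suff -> : ((\row_i Xcoef D i, \row_i Ycoef D i),
    \sum_i (Xcoef D i * w i d - Ycoef D i * u i d) + Tcoef (g 0) D) = D by [].
rewrite [RHS]surjective_pairing [D.1]surjective_pairing; congr ((_, _), _).
- by apply/rowP => i; rewrite mxE.
- by apply/rowP => i; rewrite mxE.
- by rewrite /Tcoef /u /w /x /y subrr addrC subrK.
Qed.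

End GeodesicVariation.

(** * The boundary, its tangent space and its normal *)

Section FirstOrder.
Context {R : realType}.

Lemma derive_gt0_right (h : R -> R) (l : R) : is_derive (0 : R) 1 h l -> 0 < l ->
  \forall s \near 0^'+, h 0 < h s.
Proof.
move=> dh l0; have := is_derive_cvg dh => /cvgr_gt /(_ _ l0).
rewrite near_withinE => hs; rewrite near_withinE.
apply: filterS hs => s hs s0; have : 0 < s^-1 * (h s - h 0).
  by have := hs (lt0r_neq0 s0); rewrite subr0.
by rewrite pmulr_rgt0 ?invr_gt0 // subr_gt0.
Qed.

Lemma derive_lt0_right (h : R -> R) (l : R) : is_derive (0 : R) 1 h l -> l < 0 ->
  \forall s \near 0^'+, h s < h 0.
Proof.
move=> dh l0; have dNh : is_derive (0 : R) 1 (fun s => - h s) (- l) by exact: is_derive_opp.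
have := derive_gt0_right dNh; rewrite oppr_gt0 => /(_ l0).
by apply: filterS => s; rewrite ltrN2.
Qed.

Lemma line_cvg (V : normedModType R) (z v : V) :
  (fun s : R => z + s *: v) @ (0 : R) --> z.
Proof.
have [/derivable1_diffP/differentiable_continuous + _] := is_derive_line z v (0 : R).
by rewrite /prop_for /continuous_at scale0r addr0.
Qed.

(** On the kernel of [phi] the form [xi] is nonpositive, as is seen by pushing a
kernel vector slightly into the half-space where phi < 0; by linearity it vanishes
there. *)
Lemma proportional_of_sign (V : lmodType R) (phi xi : V -> R) (e D1 : V) :
  (forall (a : R) v w, phi (a *: v + w) = a * phi v + phi w) ->
  (forall (a : R) v w, xi (a *: v + w) = a * xi v + xi w) ->
  phi e != 0 -> 0 < xi D1 -> (forall D, phi D < 0 -> xi D <= 0) ->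
  exists2 k : R, 0 < k & forall D, xi D = k * phi D.
Proof.
move=> phiL xiL e0 xi1 sgn.
have phi0 : phi 0 = 0 by have := phiL (-1) 0 0; rewrite scaler0 addr0 mulN1r addNr.
have phiZ a v : phi (a *: v) = a * phi v by rewrite -[a *: v]addr0 phiL phi0 addr0.
have xi0 : xi 0 = 0 by have := xiL (-1) 0 0; rewrite scaler0 addr0 mulN1r addNr.
have xiZ a v : xi (a *: v) = a * xi v by rewrite -[a *: v]addr0 xiL xi0 addr0.
(* Normalized so that phi b = -1. *)
pose b := - (phi e)^-1 *: e.
have phib : phi b = -1 by rewrite phiZ mulNr mulVf.
have ker_le D : phi D = 0 -> xi D <= 0.
  move=> D0; rewrite leNgt; apply/negP => Dpos.
  have N0 : 0 < `|xi b| + 1 by rewrite ltr_wpDl.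
  pose eps := xi D / (`|xi b| + 1); have eps0 : 0 < eps by rewrite divr_gt0.
  have : xi (eps *: b + D) <= 0 by apply: sgn; rewrite phiL D0 phib addr0 mulrN1 oppr_lt0.
  have : eps * (`|xi b| + 1) = xi D by rewrite divfK // gt_eqF.
  have := ler_norm (- xi b); rewrite normrN xiL; nra.
have ker D : phi D = 0 -> xi D = 0.
  move=> D0; apply/eqP; rewrite eq_le ker_le //=.
  by rewrite -oppr_le0 -mulN1r -xiZ ker_le // phiZ D0 mulr0.
have prop D : xi D = - xi b * phi D.
  have : xi (phi D *: b + D) = 0 by apply: ker; rewrite phiL phib mulrN1 addNr.
  by rewrite xiL => h; lra.
have b_le : xi b <= 0 by apply: sgn; rewrite phib; lra.
exists (- xi b) => //; rewrite lt_neqAle oppr_ge0 b_le andbT.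
by apply: contraTneq xi1 => k0; rewrite prop -k0 mul0r ltxx.
Qed.

End FirstOrder.

Section Boundary.
Context {R : realType} {n : nat}.
Variables (E U : set (heis R n)) (f : heis R n -> R).
Hypotheses (closedE : closed E) (openU : open U) (C1f : C1_on U f).
Hypothesis crit : forall z, U z -> exists v : heis R n, 'D_v f z != 0.
Hypothesis EU : E `&` U = [set z | U z /\ f z <= 0].

Lemma in_sublevel z : U z -> E z <-> f z <= 0.
Proof.
move=> Uz; split=> [Ez|fz].
  by have : (E `&` U) z by []; rewrite EU => -[].
by have : [set z | U z /\ f z <= 0] z by []; rewrite -EU => -[].
Qed.

Lemma is_derive_ray z v : U z -> is_derive (0 : R) 1 (fun s => f (z + s *: v)) ('D_v f z).
Proof.
move=> Uz; have dl := is_derive_line z v (0 : R).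
have z0 : z + (0 : R) *: v = z by rewrite scale0r addr0.
have df : differentiable f (z + (0 : R) *: v) by rewrite z0; exact: (C1f Uz).1.
by have := is_derive_along df dl; rewrite z0.
Qed.

Lemma derive_linear z (a : R) v w : U z ->
  'D_(a *: v + w) f z = a * 'D_v f z + 'D_w f z.
Proof. by move=> Uz; rewrite -{1}[w]scale1r derive_lin ?mul1r //; exact: (C1f Uz).1. Qed.

Lemma near_U (c : R -> heis R n) (s : R) : {for s, continuous c} -> U (c s) ->
  \forall s' \near s, U (c s').
Proof. by move=> cc Uc; apply: cc; exact: open_nbhs_nbhs. Qed.

(** A point of [E] where f < 0 is interior by continuity. A point where f = 0 is not,
because [f] increases along some direction. *)
Lemma boundary_level z : U z -> boundary E z <-> f z = 0.
Proof.
move=> Uz; split=> [[]|fz].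
  rewrite -(closure_id E).1 // => /(in_sublevel Uz) fz nint.
  apply/eqP; rewrite eq_le fz leNgt; apply/negP => fz0; apply: nint.
  have cf : {for z, continuous f} by exact/differentiable_continuous/(C1f Uz).1.
  have : \forall z' \near z, f z' < 0 /\ U z'.
    near=> z'; split; near: z'; last exact: open_nbhs_nbhs.
    exact: (cvgr_lt (f z)).
  by apply: filterS => z' [/ltW fz' Uz']; apply/in_sublevel.
split; first by apply: subset_closure; apply/in_sublevel; rewrite // fz.
move=> Eint.
have [v v0] : exists v : heis R n, 0 < 'D_v f z.
  have [v] := crit Uz; rewrite neq_lt => /orP[v0|v0]; last by exists v.
  exists (-1 *: v + 0); rewrite derive_linear // derive0 addr0 mulN1r oppr_gt0 //.
have ray := @line_cvg _ _ z v.
near (0 : R)^'+ => s.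
have : E (z + s *: v) /\ U (z + s *: v).
  split; near: s; apply: (@cvg_within _ (nbhs (0 : R))).
    exact: ray.
  by apply: ray; exact: open_nbhs_nbhs.
move=> [Es Us]; have : f (z + s *: v) <= 0 by apply/in_sublevel.
apply/negP; rewrite -ltNge; near: s.
by have := derive_gt0_right (is_derive_ray v Uz) v0; rewrite scale0r addr0 fz.
Unshelve. all: by end_near. Qed.

(** One inclusion differentiates f (c s) = 0, the other is [implicit_curve]. *)
Lemma tangent_kernel q v : U q -> boundary E q ->
  tangent_space (boundary E) q v <-> 'D_v f q = 0.
Proof.
move=> Uq bq; have fq := (boundary_level Uq).1 bq; split.
  move=> [c [e [e0 c0 c'0 cP]]].
  have [_ dc _] := cP 0 ltac:(by rewrite normr0).
  have dcv : is_derive (0 : R) 1 c v by rewrite -c'0 derive1E; exact: derivableP.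
  have cc : {for 0, continuous c} by exact/differentiable_continuous/derivable1_diffP.
  have := @is_derive_along _ _ f c 0 v; rewrite c0 => /(_ (C1f Uq).1 dcv) [_ <-].
  have near_e : \forall s \near (0 : R), `|s| < e.
    have := @cvgr_norm_lt _ _ _ _ _ (fun x : R => x) 0 cvg_id e.
    by rewrite normr0; apply.
  have -> : 'D_1 (f \o c) 0 = 'D_1 (cst (0 : R)) (0 : R).
    apply: near_eq_derive; near=> s => /=.
    apply/boundary_level; first by near: s; apply: near_U => //; rewrite c0.
    have se : `|s| < e by near: s.
    by have [] := cP s se.
  exact: derive_cst.
move=> Dv; have [e De] := crit Uq.
have [z Uz|z w Uz|c [r [r0 c0 c'0 cP]]] := implicit_curve openU Uq _ _ fq Dv De.
- exact: (C1f Uz).1.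
- exact: (C1f Uz).2.
exists c, r; split; [exact: r0|exact: c0|exact: c'0|] => s sr; have [Uc fc dc cc] := cP s sr.
by split; [apply/boundary_level|exact: dc|exact: cc].
Unshelve. all: by end_near. Qed.

(** [N q] is orthogonal to the kernel of the differential of [f], hence dual to a
multiple of it. The factor is positive because [f] does not decrease along the outer
normal. *)
Lemma normal_conormal N q : outer_unit_normal E N -> U q -> boundary E q ->
  exists2 m : R, 0 < m & forall D, metric q (N q) D = m * 'D_D f q.
Proof.
move=> NE Uq bq; have [N1 Ntan Nout] := NE q bq.
have fq := (boundary_level Uq).1 bq.
have [e De] := crit Uq.
have prop D : metric q (N q) D = metric q (N q) e / 'D_e f q * 'D_D f q.
  have := Ntan (- ('D_D f q / 'D_e f q) *: e + D).
  rewrite tangent_kernel // derive_linear // mulNr divfK // addNr metric_lin => /(_ erefl) h.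
  by apply/eqP; rewrite -subr_eq0 -[X in _ == X]h; apply/eqP; field.
have NN : metric q (N q) (N q) = 1.
  by have := N1; rewrite /mnorm => /(congr1 (fun r : R => r ^+ 2));
    rewrite expr1n sqr_sqrtr ?metric_ge0.
exists (metric q (N q) e / 'D_e f q) => //.
have dN : 0 <= 'D_(N q) f q.
  rewrite leNgt; apply/negP => dN.
  have ray := @line_cvg _ _ q (N q).
  near (0 : R)^'+ => s.
  have : ~ E (q + s *: N q) by near: s.
  apply; apply/in_sublevel.
    by near: s; apply: (@cvg_within _ (nbhs (0 : R))); apply: ray; exact: open_nbhs_nbhs.
  apply/ltW; near: s.
  by have := derive_lt0_right (is_derive_ray (N q) Uq) dN; rewrite scale0r addr0 fq.
rewrite ltNge; apply/negP => m_le0; have := mulr_le0_ge0 m_le0 dN.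
by rewrite -prop NN ler10.
Unshelve. all: by end_near. Qed.

End Boundary.

(** * Bounded Lipschitz functions *)

Section BoundedLipschitz.
Context {R : realType} {V : normedModType R}.
Implicit Types (B : set V) (f g : V -> R).

(** Boundedness is part of the class to make it stable under products; one constant
serves for both bounds. *)
Definition bounded_lipschitz B f := exists2 M : R, 0 <= M &
  (forall z, B z -> `|f z| <= M) /\
  (forall z z', B z -> B z' -> `|f z - f z'| <= M * `|z - z'|).

Lemma bounded_lipschitzS B B' f : B `<=` B' ->
  bounded_lipschitz B' f -> bounded_lipschitz B f.
Proof. by move=> BB' [M M0 [fM fL]]; exists M => //; split=> *; [apply: fM|apply: fL]; exact: BB'. Qed.

Lemma bounded_lipschitz_cst B (a : R) : bounded_lipschitz B (fun=> a).
Proof.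
exists `|a| => //; split=> // z z' _ _.
by rewrite subrr normr0 mulr_ge0.
Qed.

Lemma bounded_lipschitzD B f g : bounded_lipschitz B f -> bounded_lipschitz B g ->
  bounded_lipschitz B (fun z => f z + g z).
Proof.
move=> [M M0 [fM fL]] [K K0 [gK gL]]; exists (M + K); first exact: addr_ge0.
split=> [z Bz|z z' Bz Bz']; first by rewrite (le_trans (ler_normD _ _)) // lerD ?fM ?gK.
rewrite opprD addrACA mulrDl (le_trans (ler_normD _ _)) // lerD ?fL ?gL //.
Qed.

Lemma bounded_lipschitzM B f g : bounded_lipschitz B f -> bounded_lipschitz B g ->
  bounded_lipschitz B (fun z => f z * g z).
Proof.
move=> [M M0 [fM fL]] [K K0 [gK gL]]; have MK : 0 <= M * K by rewrite mulr_ge0.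
exists (2 * (M * K)); first by rewrite mulr_ge0.
split=> [z Bz|z z' Bz Bz'].
  rewrite normrM (le_trans (ler_pM _ _ (fM z Bz) (gK z Bz))) //; lra.
have -> : f z * g z - f z' * g z' = f z * (g z - g z') + (f z - f z') * g z' by ring.
rewrite (le_trans (ler_normD _ _)) // !normrM.
have h1 := ler_pM (normr_ge0 _) (normr_ge0 _) (fM z Bz) (gL _ _ Bz Bz').
have h2 := ler_pM (normr_ge0 _) (normr_ge0 _) (fL _ _ Bz Bz') (gK z' Bz').
apply: le_trans (lerD h1 h2) _.
by rewrite le_eqVlt; apply/orP; left; apply/eqP; ring.
Qed.

Lemma bounded_lipschitz_sum B (I : Type) (r : seq I) (F : I -> V -> R) :
  (forall i, bounded_lipschitz B (F i)) ->
  bounded_lipschitz B (fun z => \sum_(i <- r) F i z).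
Proof.
move=> lF; elim: r => [|i r IH].
  rewrite (_ : (fun _ => _) = fun=> 0); first exact: bounded_lipschitz_cst.
  by apply/funext => z; rewrite big_nil.
rewrite (_ : (fun _ => _) = fun z => F i z + \sum_(i <- r) F i z).
  exact: bounded_lipschitzD.
by apply/funext => z; rewrite big_cons.
Qed.

Lemma bounded_lipschitzV B f (c : R) : 0 < c -> (forall z, B z -> c <= f z) ->
  bounded_lipschitz B f -> bounded_lipschitz B (fun z => (f z)^-1).
Proof.
move=> c0 cf [M M0 [fM fL]].
have f0 z : B z -> 0 < f z by move=> /cf; exact: lt_le_trans.
have fV z : B z -> `|(f z)^-1| <= c^-1.
  by move=> Bz; rewrite normfV gtr0_norm ?f0 // lef_pV2 ?posrE ?f0 // cf.
have cV0 : 0 <= c^-1 by rewrite invr_ge0 ltW.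
exists (c^-1 + c^-1 * c^-1 * M); first by rewrite addr_ge0 // !mulr_ge0.
split=> [z Bz|z z' Bz Bz'].
  by rewrite (le_trans (fV z Bz)) // lerDl !mulr_ge0.
have -> : (f z)^-1 - (f z')^-1 = (f z)^-1 * (f z')^-1 * (f z' - f z).
  by field; rewrite !gt_eqF ?f0.
rewrite !normrM.
have h1 := ler_pM (normr_ge0 _) (normr_ge0 _) (fV z Bz) (fV z' Bz').
have h2 := ler_pM (mulr_ge0 (normr_ge0 _) (normr_ge0 _)) (normr_ge0 _) h1 (fL _ _ Bz' Bz).
apply: le_trans h2 _; rewrite mulrDl (distrC z') mulrA lerDr.
by rewrite mulr_ge0.
Qed.

Lemma bounded_lipschitz_sqrt B f (c : R) : 0 < c -> (forall z, B z -> c <= f z) ->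
  bounded_lipschitz B f -> bounded_lipschitz B (fun z => Num.sqrt (f z)).
Proof.
move=> c0 cf [M M0 [fM fL]].
have f0 z : B z -> 0 < f z by move=> /cf; exact: lt_le_trans.
pose k := Num.sqrt c; have k0 : 0 < k by rewrite sqrtr_gt0.
have kV0 : 0 <= k^-1 by rewrite invr_ge0 ltW.
exists ((M + 1) + k^-1 * M); first by rewrite !addr_ge0 // mulr_ge0.
split=> [z Bz|z z' Bz Bz'].
  rewrite ger0_norm ?sqrtr_ge0 // (le_trans (sqrtr_le_half_succ (ltW (f0 z Bz)))) //.
  have := fM z Bz; have := ler_norm (f z); have := mulr_ge0 kV0 M0; lra.
have sz : k <= Num.sqrt (f z) by rewrite ler_wsqrtr // cf.
have sz' : 0 <= Num.sqrt (f z') by exact: sqrtr_ge0.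
have dsq : (Num.sqrt (f z) - Num.sqrt (f z')) * (Num.sqrt (f z) + Num.sqrt (f z')) = f z - f z'.
  by rewrite -subr_sqr !sqr_sqrtr // ltW // f0.
have h := fL _ _ Bz Bz'.
apply: (@le_trans _ _ (k^-1 * (M * `|z - z'|))); last first.
  by rewrite mulrDl -mulrA lerDr mulr_ge0 // addr_ge0.
rewrite -ler_pdivrMl ?invr_gt0 // invrK; apply: le_trans h.
rewrite -dsq normrM mulrC ler_wpM2l // ger0_norm ?addr_ge0 ?sqrtr_ge0 //.
by rewrite -[k]addr0 lerD.
Qed.

End BoundedLipschitz.

(** * Regularity of the curvature *)

Section CurvatureLipschitz.
Context {R : realType} {n : nat}.
Implicit Types (B A : set (heis R n)) (F N : heis R n -> heis R n) (p q v z : heis R n).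

Lemma coordinates_le_norm v i :
  [/\ `|v.1.1 0 i| <= `|v|, `|v.1.2 0 i| <= `|v| & `|v.2| <= `|v|].
Proof.
have le1 : `|v.1| <= `|v| by rewrite [leRHS]/Num.norm /= le_max lexx.
have entry (r : 'rV[R]_n) : `|r 0 i| <= `|r|.
  rewrite [leRHS]/Num.norm /= mx_normrE; exact: (le_bigmax _ (fun ij => `|r ij.1 ij.2|) (0, i)).
split.
- apply: le_trans (entry _) (le_trans _ le1).
  by rewrite [leRHS]/Num.norm /= le_max lexx.
- apply: le_trans (entry _) (le_trans _ le1).
  by rewrite [leRHS]/Num.norm /= le_max lexx orbT.
- by rewrite [leRHS]/Num.norm /= le_max lexx orbT.
Qed.

Lemma bounded_lipschitz_coordinates B F (L q0 : R) : 0 <= L ->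
  (forall z z', B z -> B z' -> `|F z - F z'| <= L * `|z - z'|) ->
  (forall z, B z -> `|F z| <= q0) ->
  [/\ forall i, bounded_lipschitz B (fun z => (F z).1.1 0 i),
      forall i, bounded_lipschitz B (fun z => (F z).1.2 0 i) &
      bounded_lipschitz B (fun z => (F z).2)].
Proof.
move=> L0 FL Fb; have M0 : 0 <= L + `|q0| by rewrite addr_ge0.
have FL' z z' : B z -> B z' -> `|F z - F z'| <= (L + `|q0|) * `|z - z'|.
  by move=> Bz Bz'; rewrite (le_trans (FL _ _ Bz Bz')) // ler_wpM2r // lerDl.
have Fb' z : B z -> `|F z| <= L + `|q0|.
  by move=> Bz; rewrite (le_trans (Fb _ Bz)) // (le_trans (ler_norm _)) // lerDr.
split=> [i|i|]; exists (L + `|q0|) => //; split=> [z Bz|z z' Bz Bz'].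
- by have [h _ _] := coordinates_le_norm (F z) i; rewrite (le_trans h) ?Fb'.
- have [h _ _] := coordinates_le_norm (F z - F z') i.
  by move: h; rewrite !mxE => h; rewrite (le_trans h) ?FL'.
- by have [_ h _] := coordinates_le_norm (F z) i; rewrite (le_trans h) ?Fb'.
- have [_ h _] := coordinates_le_norm (F z - F z') i.
  by move: h; rewrite !mxE => h; rewrite (le_trans h) ?FL'.
- have h : `|(F z).2| <= `|F z| by rewrite [leRHS]/Num.norm /= le_max lexx orbT.
  by rewrite (le_trans h) ?Fb'.
- have h : `|(F z - F z').2| <= `|F z - F z'|.
    by rewrite [leRHS]/Num.norm /= le_max lexx orbT.
  by rewrite (le_trans h) ?FL'.
Qed.

(** In the frame, the numerator 2 <N, T> and the square S of the denominator are
polynomials in the coordinates of [z] and [N z], hence bounded and Lipschitz near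
[q]. The radius [r] is chosen so that S stays above S(q) / 2. *)
Lemma normal_curvature_lipschitz A N q : A q -> [lipschitz N z | z in A] ->
  0 < mnorm q (hproj q (N q)) ->
  exists2 U, nbhs q U & [lipschitz normal_curvature N z | z in A `&` U].
Proof.
move=> Aq /pinfty_ex_gt0[L L0 NL] hq.
have {}NL z z' : A z -> A z' -> `|N z - N z'| <= L * `|z - z'|.
  by move=> Az Az'; exact: NL (z, z') _.
pose S z := \sum_i (Xcoef (N z) i ^+ 2 + Ycoef (N z) i ^+ 2).
pose B1 := A `&` [set z | `|q - z| < 1].
have B1q : B1 q by split=> //=; rewrite subrr normr0.
have idb z : B1 z -> `|z| <= `|q| + 1.
  move=> [_ /= zq]; rewrite -[z](subKr q).
  by rewrite (le_trans (ler_normB _ _)) // lerD // ltW.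
have Nb z : B1 z -> `|N z| <= `|N q| + L.
  move=> [Az /= zq]; rewrite -[N z](subKr (N q)).
  rewrite (le_trans (ler_normB _ _)) // lerD // (le_trans (NL _ _ Aq Az)) //.
  by rewrite ler_piMr // ltW.
have [x1 y1 _] : [/\ forall i, bounded_lipschitz B1 (fun z => z.1.1 0 i),
    forall i, bounded_lipschitz B1 (fun z => z.1.2 0 i) & bounded_lipschitz B1 (fun z => z.2)].
  apply: (@bounded_lipschitz_coordinates B1 id 1 _ ler01 _ idb) => z z' _ _.
  by rewrite mul1r.
have [Nx Ny Nt] : [/\ forall i, bounded_lipschitz B1 (fun z => (N z).1.1 0 i),
    forall i, bounded_lipschitz B1 (fun z => (N z).1.2 0 i) &
    bounded_lipschitz B1 (fun z => (N z).2)].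
  apply: (@bounded_lipschitz_coordinates B1 N L _ (ltW L0) _ Nb) => z z' [Az _] [Az' _].
  exact: NL.
have lS : bounded_lipschitz B1 S.
  rewrite /S (_ : (fun _ => _) = fun z => \sum_i (Xcoef (N z) i * Xcoef (N z) i
    + Ycoef (N z) i * Ycoef (N z) i)); last first.
    by apply/funext => z; apply: eq_bigr => i _; rewrite !expr2.
  apply: bounded_lipschitz_sum => i.
  by apply: bounded_lipschitzD; apply: bounded_lipschitzM; rewrite /Xcoef /Ycoef.
have lT : bounded_lipschitz B1 (fun z => Tcoef z (N z)).
  rewrite /Tcoef (_ : (fun _ => _) = fun z => (N z).2 + (-1) * \sum_i
     ((N z).1.1 0 i * z.1.2 0 i + (-1) * ((N z).1.2 0 i * z.1.1 0 i))); last first.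
    apply/funext => z; rewrite mulN1r; congr (_ - _); apply: eq_bigr => i _.
    by rewrite mulN1r.
  apply: bounded_lipschitzD => //; apply: bounded_lipschitzM.
    exact: bounded_lipschitz_cst.
  apply: bounded_lipschitz_sum => i; apply: bounded_lipschitzD.
    exact: bounded_lipschitzM.
  apply: bounded_lipschitzM; first exact: bounded_lipschitz_cst.
  exact: bounded_lipschitzM.
have Sq : 0 < S q by move: hq; rewrite mnorm_hproj sqrtr_gt0.
have [M M0 [SM SL]] := lS.
pose r := Num.min 1 (S q / (2 * (M + 1))).
have M1 : 0 < 2 * (M + 1) by rewrite mulr_gt0 // ltr_wpDl.
have r0 : 0 < r by rewrite lt_min ltr01 divr_gt0.
pose U := [set z | `|q - z| < r].
have B2B1 : A `&` U `<=` B1.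
  by move=> z [Az /= zr]; split=> //=; rewrite (lt_le_trans zr) // ge_min lexx.
have S_ge z : (A `&` U) z -> S q / 2 <= S z.
  move=> Bz; have B1z := B2B1 _ Bz; case: Bz => Az /= zr.
  have h1 := SL _ _ B1q B1z; have h2 := ler_norm (S q - S z).
  have zr' : `|q - z| < S q / (2 * (M + 1)).
    by rewrite (lt_le_trans zr) // ge_min lexx orbT.
  have : `|q - z| * (2 * (M + 1)) < S q by rewrite -ltr_pdivlMr.
  have := normr_ge0 (q - z); nra.
exists U; first exact: (@cvgr_dist_lt _ _ _ _ _ (fun z : heis R n => z) q cvg_id r r0).
have [K K0 [_ KL]] : bounded_lipschitz (A `&` U) (normal_curvature N).
  rewrite (_ : normal_curvature N =
      fun z => (2 * Tcoef z (N z)) * (Num.sqrt (S z))^-1); last first.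
    by apply/funext => z; rewrite /normal_curvature mnorm_hproj Tcoef_metric.
  apply: bounded_lipschitzM.
    apply: bounded_lipschitzM; first exact: bounded_lipschitz_cst.
    exact: bounded_lipschitzS lT.
  have c0 : 0 < S q / 2 by rewrite divr_gt0.
  apply: (@bounded_lipschitzV _ _ _ _ (Num.sqrt (S q / 2))).
  - by rewrite sqrtr_gt0.
  - by move=> z Bz; rewrite ler_wsqrtr // S_ge.
  - apply: (@bounded_lipschitz_sqrt _ _ _ _ _ c0) => //.
    exact: bounded_lipschitzS lS.
have ABq : (A `&` U) q by split=> //; rewrite /U /= subrr normr0.
apply: (@klipschitzW _ _ _ K).
  exact: (@globally_properfilter _ _ (q, q)).
by move=> [z z'] /= [Bz Bz']; exact: KL.
Qed.

End CurvatureLipschitz.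

Theorem theorem3p12 (R : realType) (n : nat) (n_gt0 : (0 < n)%N)
    (E : set (heis R n)) (N : heis R n -> heis R n)
    (closedE : closed E) (C1E : has_C1_boundary E)
    (outerN : outer_unit_normal E N) :
  (forall (p q : heis R n) (gamma : R -> heis R n) (lambda : R),
     ~ E p -> boundary E q -> dist_to E p = cc_dist p q ->
     minimizing_geodesic 0 (dist_to E p) lambda gamma ->
     gamma 0 = q -> gamma (dist_to E p) = p ->
     [/\ regular_set (boundary E) q,
         itv_derive 0 (dist_to E p) gamma 0 = horizontal_normal N q
       & lambda = normal_curvature N q]) /\
  ([lipschitz N z | z in boundary E] ->
   locally_lipschitz_on (boundary E `\` singular_set (boundary E))
     (normal_curvature N)).
Proof.
split=> [p q gamma lambda nEp bq _ [geo _] g0 gd|lipN q [bq nsing]].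
- have [U [f [oU Uq C1f crit EU]]] := C1E q bq.
  have Eq : E q by have [+ _] := bq; rewrite -(closure_id E).1.
  have d0 : 0 < dist_to E p.
    rewrite lt_neqAle dist_to_ge0 andbT; apply/negP => /eqP d0; apply: nEp.
    by rewrite -gd -d0 g0.
  have [hv v1 var] := geodesic_first_variation d0 geo.
  move: hv v1 var; rewrite g0 gd; set v := itv_derive _ _ _ _ => hv v1 var.
  pose Z := v + (lambda / 2) *: Tfield.
  have fq : f q = 0 by apply/(boundary_level closedE oU C1f crit EU Uq).
  have vv : metric q v v = 1.
    by have := v1; rewrite /mnorm => /(congr1 (fun r : R => r ^+ 2));
      rewrite expr1n sqr_sqrtr ?metric_ge0.
  have Zv : metric q Z v = 1.
    rewrite metricC /Z metricD metricZ Tcoef_metric vv.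
    by rewrite ((horizontalP _ _).1 hv) mulr0 addr0.
  (* Otherwise the end of a curve shorter than the distance enters E. *)
  have sgn D : 'D_D f q < 0 -> metric q Z D <= 0.
    move=> Df; rewrite leNgt; apply/negP => /var[K near_short].
    pose c (s : R) : heis R n := q + s *: D + (s ^+ 2 * K) *: Tfield.
    (* The quadratic correction does not affect the velocity of the moved end. *)
    have dc : is_derive (0 : R) 1 c D.
      have dsq : is_derive (0 : R) 1 (fun s : R => s ^+ 2 * K) 0.
        by apply: is_derive_eq; rewrite /GRing.scale /=; ring.
      have -> : c = (fun s => q + s *: D) + (fun s : R => (s ^+ 2 * K) *: Tfield) by [].
      have -> : D = D + 0 *: Tfield by rewrite scale0r addr0.
      by apply: is_deriveD; [rewrite scale0r addr0; exact: is_derive_line|exact: is_derive_scalel].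
    have c0 : c 0 = q by rewrite /c expr0n mul0r !scale0r !addr0.
    have near_E : \forall s \near 0^'+, E (c s).
      have fc : differentiable f (c 0) by rewrite c0; exact: (C1f _ Uq).1.
      have dfc : is_derive (0 : R) 1 (f \o c) ('D_D f q) by rewrite -c0; exact: is_derive_along.
      have cc : {for 0, continuous c} by case: dc => /derivable1_diffP/differentiable_continuous.
      have Uc : \forall s \near 0^'+, U (c s).
        by apply: (@cvg_within _ (nbhs (0 : R))); apply: near_U; rewrite ?c0.
      near=> s; apply/(in_sublevel EU); first by near: s.
      apply/ltW; near: s.
      by have := derive_lt0_right dfc Df; rewrite /= c0 fq.
    near (0 : R)^'+ => s.
    have Es : E (c s) by near: s.
    have := dist_to_le p Es; apply/negP; rewrite -ltNge; near: s.
    exact: near_short.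
  have [e De] := crit q Uq.
  have Z1 : 0 < metric q Z v by rewrite Zv.
  have [k k0 Zk] := proportional_of_sign
    (fun a v w => derive_linear C1f a v w Uq) (metric_lin q Z) De Z1 sgn.
  have [m m0 Nm] := normal_conormal closedE oU C1f crit EU outerN Uq bq.
  have NZ : N q = (m / k) *: Z.
    apply: (@metric_inj _ _ q) => D.
    rewrite [RHS]metricC metricZ [X in _ * X]metricC Zk Nm.
    by field; rewrite gt_eqF.
  have mk0 : 0 < m / k by rewrite divr_gt0.
  have [-> ->] := normal_of_direction hv v1 mk0 NZ.
  split => //; split => // -[_ sing].
  have : tangent_space (boundary E) q v by rewrite sing.
  rewrite (tangent_kernel closedE oU C1f crit EU) // => Dv.
  by move: Zv; rewrite Zk Dv mulr0 => /eqP; rewrite eq_sym oner_eq0.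
- have [U [f [oU Uq C1f crit EU]]] := C1E q bq.
  have [m m0 Nm] := normal_conormal closedE oU C1f crit EU outerN Uq bq.
  (* If N q were vertical, the kernel of the differential, which is the tangent
     space, would be the horizontal space. *)
  have hq : 0 < mnorm q (hproj q (N q)).
    rewrite lt_neqAle sqrtr_ge0 andbT; apply/negP => /eqP/esym; rewrite mnorm_hproj => S0.
    apply: nsing; split=> //; apply/funext => D; apply/propext.
    rewrite (tangent_kernel closedE oU C1f crit EU) // horizontalP.
    have XY i : Xcoef (N q) i = 0 /\ Ycoef (N q) i = 0.
      have sum0 : \sum_i (Xcoef (N q) i ^+ 2 + Ycoef (N q) i ^+ 2) = 0.
        apply/eqP; rewrite eq_le -sqrtr_eq0 S0 eqxx sumr_ge0 // => j _.
        by rewrite addr_ge0 ?sqr_ge0.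
      have /eqP : Xcoef (N q) i ^+ 2 + Ycoef (N q) i ^+ 2 = 0.
        by apply: (psumr_eq0P _ sum0) => // j _; rewrite addr_ge0 ?sqr_ge0.
      by rewrite paddr_eq0 ?sqr_ge0 // !expf_eq0 /= => /andP[/eqP-> /eqP->].
    have NT D' : metric q (N q) D' = Tcoef q (N q) * Tcoef q D'.
      rewrite /metric big1 ?add0r // => i _.
      by have [-> ->] := XY i; rewrite !mul0r addr0.
    have T0 : Tcoef q (N q) != 0.
      have [N1 _ _] := outerN q bq; apply/eqP => T0; move: N1.
      by rewrite /mnorm NT T0 mul0r sqrtr0 => /eqP; rewrite eq_sym oner_eq0.
    have := Nm D; rewrite NT => NmD; split=> [Df|TD].
      by move/eqP: NmD; rewrite Df mulr0 mulf_eq0 (negbTE T0) => /eqP.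
    by move/eqP: NmD; rewrite TD mulr0 eq_sym mulf_eq0 gt_eqF // => /eqP.
  have [W Wq lipW] := normal_curvature_lipschitz bq lipN hq.
  exists W => //; apply: sub_lipschitz lipW => P PW z [[[Az _] Wz] [[Az' _] Wz']].
  exact: PW.
Unshelve. all: by end_near. Qed.
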